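(* Let $k_1<k_2$, $\lambda_1$, $\lambda_2$ be positive integers with $\lambda_1k_2(k_2-1)=\lambda_2k_1(k_1-1)$. Then there exists an integer $v_0$ such that for every $v\geq v_0$ satisfying $\lambda_1(v-1)\equiv 0\pmod{k_1-1}$, $\lambda_1 v(v-1)\equiv 0\pmod{k_1(k_1-1)}$ and $\lambda_2(v-1)\equiv 0\pmod{k_2-1}$, there exists a $(k_2,\lambda_2;k_1,\lambda_1)$-nesting on $v$ points.
   Context: A $(v,k,\lambda)$-BIBD is a pair $(X,\mathcal{B})$ with $|X|=v$ and $\mathcal{B}$ a (multi)set of $k$-subsets of $X$ (blocks) such that every pair of distinct points lies in exactly $\lambda$ blocks. For $k_1<k_2$, a $(k_2,\lambda_2;k_1,\lambda_1)$-nesting on $v$ points is a $(v,k_2,\lambda_2)$-BIBD $(X,\mathcal{B})$ together with, for each block $B\in\mathcal{B}$, a distinguished subset $B'\subseteq B$ with $|B'|=k_1$, such that $(X,\{B'\mid B\in\mathcal{B}\})$ is a $(v,k_1,\lambda_1)$-BIBD. *)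

(* Defs.v *)
From mathcomp Require Import all_boot.

Set Implicit Arguments.
Unset Strict Implicit.
Unset Printing Implicit Defensive.

(* A multiset of blocks is a family [B : I -> {set X}] over a finite type [I]:
   the indices are the block occurrences, so repeated blocks are allowed and
   counting indices counts blocks with multiplicity. *)
Definition is_BIBD (v k lambda : nat) (X I : finType) (B : I -> {set X}) : Prop :=
  [/\ #|X| = v,
      forall i : I, #|B i| = k
    & forall x y : X, x != y ->
        #|[set i : I | (x \in B i) && (y \in B i)]| = lambda].

(* [B' i] is the subset distinguished in the block occurrence [B i]; equal
   blocks at different indices may have different distinguished subsets. *)
Definition is_nesting (v k2 lambda2 k1 lambda1 : nat) (X I : finType)
    (B B' : I -> {set X}) : Prop :=
  [/\ is_BIBD v k2 lambda2 B,
      forall i : I, B' i \subset B i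
    & is_BIBD v k1 lambda1 B'].

Definition has_nesting (k2 lambda2 k1 lambda1 v : nat) : Prop :=
  exists (X I : finType) (B B' : I -> {set X}),
    is_nesting v k2 lambda2 k1 lambda1 B B'.

(* Main.v *)
Require Import Defs.
From HB Require Import structures.
From mathcomp Require Import all_boot all_order all_fingroup all_algebra all_field.
From mathcomp Require Import cyclic zify ring boolp.

Set Implicit Arguments.
Unset Strict Implicit.
Unset Printing Implicit Defensive.

Import GRing.Theory Num.Theory Order.TTheory.

(** Record a nested block as an injection of [k2] positions into the point set,
    and colour a pair of positions by whether both lie among the first [k1].  A
    nesting is then a decomposition of the complete graph, taken with
    multiplicity [lambda1] in one colour and [lambda2 - lambda1] in the other,
    into copies of one two-coloured clique, and Wilson's method applies.

    - Finite fields: if [q] is large and [q = 1] modulo [2 k1 (k1 - 1)], base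
      blocks whose differences lie in prescribed cyclotomic classes exist by a
      second moment argument; developing them gives a nesting on [q] points.

    - Large index to index one: on a complete multipartite graph satisfying the
      divisibility conditions the multiplicities are an integral combination of
      blocks; adding copies of the family of all blocks makes the coefficients
      nonnegative, at the price of multiplying the multiplicities by any large
      [q].  When [q] is the order of a field this factor is absorbed by
      replacing each point by a vector space over the field.

    - Closure: transversal designs combine these ingredients.  They yield [D]
      such that group divisible designs with [m] groups of size [D] and nestings
      on [m D + 1] points exist for all [m >= k2 + 4]; then, for an admissible
      residue class, [k2 + 4] groups of size [w D m] with a common hole of size
      [w], and one more group carrying the right residue, reach every large
      admissible [v]. *)

(** * Decompositions into coloured cliques *)

Section Framework.
Variables (k : nat) (col : 'I_k -> 'I_k -> bool) (mu : bool -> nat).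

Definition hits (X : eqType) (b : 'I_k -> X) (c : bool) (x y : X) : nat :=
  \sum_(p : 'I_k * 'I_k | (p.1 != p.2) && (col p.1 p.2 == c))
     ((b p.1 == x) && (b p.2 == y)).

(* The diagonal is included: when [r] is irreflexive this forces every [b i] to
   be injective. *)
Definition decomp (X : finType) (r : rel X) : Prop :=
  exists (I : finType) (b : I -> 'I_k -> X),
    forall c x y, \sum_i hits (b i) c x y = mu c * r x y.

Lemma hits_comp (X Y : finType) (e : Y -> X) (b : 'I_k -> Y) c x y :
  hits (e \o b) c x y =
  \sum_(q : Y * Y) ((e q.1 == x) && (e q.2 == y)) * hits b c q.1 q.2.
Proof.
rewrite /hits; under [RHS]eq_bigr do rewrite big_distrr /=.
rewrite exchange_big /=; apply: eq_bigr => p _.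
rewrite (bigD1 (b p.1, b p.2)) //= !eqxx muln1 big1 ?addn0 // => -[q1 q2] /=.
rewrite xpair_eqE negb_and => /orP[] /negbTE; rewrite eq_sym => ->.
  by rewrite muln0.
by rewrite andbF muln0.
Qed.

(** Decompositions of pieces glue: the blocks of piece [j] are pushed forward along [e j]. Since
    [mu] is the same for all pieces, it factors out of the count. *)
Lemma decomp_compose (X J : finType) (Y : J -> finType) (r : rel X)
    (rY : forall j, rel (Y j)) (e : forall j, Y j -> X) :
  (forall j, decomp (rY j)) ->
  (forall x y, \sum_j \sum_(q : Y j * Y j)
      ((e j q.1 == x) && (e j q.2 == y) && rY j q.1 q.2) = r x y) ->
  decomp r.
Proof.
move=> dY cov.
have /choice [I hI] : forall j, exists I : finType, exists b : I -> 'I_k -> Y j,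
    forall c x y, \sum_i hits (b i) c x y = mu c * rY j x y by [].
pose b j := sval (cid (hI j)).
have hb j : forall c x y, \sum_i hits (b j i) c x y = mu c * rY j x y
  by apply: (svalP (cid (hI j))).
exists {j : J & I j}, (fun i => e (tag i) \o b (tag i) (tagged i)) => c x y.
rewrite -cov big_distrr /=.
rewrite -(@sig_big_dep _ _ _ J (fun j => I j) xpredT (fun _ => xpredT)
  (fun j i => hits (e j \o b j i) c x y)) /=.
apply: eq_bigr => j _; under eq_bigr do rewrite hits_comp.
rewrite exchange_big /= big_distrr /=; apply: eq_bigr => q _.
rewrite -big_distrr /= hb.
by case: (_ && _) => /=; rewrite ?mul1n ?mul0n ?muln0.
Qed.

(** The last hypothesis gives an edge one piece and injectivity of [e j] gives it one preimage
    there, so the sum in [decomp_compose] is one. *)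
Lemma decomp_pieces (X J : finType) (Y : J -> finType) (r : rel X)
    (rY : forall j, rel (Y j)) (e : forall j, Y j -> X) :
  (forall j, decomp (rY j)) ->
  (forall j, injective (e j)) ->
  (forall j a b, rY j a b -> r (e j a) (e j b)) ->
  (forall x y, r x y -> exists j a b, [/\ rY j a b, e j a = x & e j b = y]) ->
  (forall j j' a b a' b', rY j a b -> rY j' a' b' ->
      e j a = e j' a' -> e j b = e j' b' -> j = j') ->
  decomp r.
Proof.
move=> dY inje hom ex uniq_; apply: (@decomp_compose X J Y r rY e dY) => x y.
case rxy: (r x y); last first.
  apply: big1 => j _; apply: big1 => -[a b] _ /=.
  case: eqP => //= eax; case: eqP => //= eby; case h: (rY j a b) => //.
  by move/hom: h; rewrite eax eby rxy.
have [j [a [b [rab ea eb]]]] := ex _ _ rxy.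
rewrite (bigD1 j) //= (bigD1 (a, b)) //= ea eb !eqxx rab /=.
rewrite !big1 ?addn0 // => [j' nj|[a' b'] /= nab].
  apply: big1 => -[a' b'] _ /=.
  case: eqP => //= ea'; case: eqP => //= eb'; case h: (rY j' a' b') => //.
  by move: nj; rewrite (uniq_ _ _ _ _ _ _ h rab) ?eqxx // ?ea' ?eb' ?ea ?eb.
case: eqP => //= ea'; case: eqP => //= eb'.
by move: nab; rewrite (inje _ _ _ (etrans ea' (esym ea))) (inje _ _ _ (etrans eb' (esym eb))) eqxx.
Qed.

Lemma decomp_eq (X : finType) (r r' : rel X) : r =2 r' -> decomp r -> decomp r'.
Proof. by move=> rr [I [b h]]; exists I, b => c x y; rewrite h rr. Qed.

Lemma decomp_union (X : finType) (r1 r2 r : rel X) :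
  (forall x y, r1 x y + r2 x y = r x y) -> decomp r1 -> decomp r2 -> decomp r.
Proof.
move=> rr [I1 [b1 h1]] [I2 [b2 h2]].
exists (I1 + I2)%type, (fun i => match i with inl i => b1 i | inr i => b2 i end) => c x y.
by rewrite big_sumType /= h1 h2 -mulnDr rr.
Qed.

Lemma decomp_bij (X Y : finType) (rX : rel X) (rY : rel Y) (f : Y -> X) :
  #|Y| = #|X| -> injective f -> (forall a b, rY a b = rX (f a) (f b)) ->
  decomp rY -> decomp rX.
Proof.
move=> cXY injf rf dY; have fM x : exists a, f a = x.
  have /imageP [a _ ->] : x \in codom f by apply: inj_card_onto; rewrite ?cXY.
  by exists a.
apply: (@decomp_pieces X unit (fun=> Y) rX (fun=> rY) (fun=> f)) => //.
- by move=> _ a b; rewrite rf.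
- move=> x y rxy; have [a fa] := fM x; have [b fb] := fM y.
  by exists tt, a, b; split; rewrite // rf fa fb.
- by case; case.
Qed.

(* Nested group divisible designs with [m] groups of size [g]. *)
Definition GDD g m := decomp (fun x y : 'I_m * 'I_g => x.1 != y.1).
Definition design v := decomp (fun x y : 'I_v => x != y).

Lemma design_type (X : finType) : design #|X| -> decomp (fun x y : X => x != y).
Proof.
move=> h; apply: (@decomp_bij X 'I_#|X| _ _ enum_val _ _ _ h).
- by rewrite card_ord.
- exact: enum_val_inj.
- by move=> a b; rewrite (inj_eq enum_val_inj).
Qed.

Lemma design_of_type (X : finType) v : #|X| = v -> decomp (fun x y : X => x != y) -> design v.
Proof.
move=> <- h; apply: (@decomp_bij _ X _ _ enum_rank _ _ _ h).
- by rewrite card_ord.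
- exact: enum_rank_inj.
- by move=> a b; rewrite (inj_eq enum_rank_inj).
Qed.

Lemma GDD_of_type (P U : finType) g m : #|U| = g -> #|P| = m ->
  decomp (fun x y : P * U => x.1 != y.1) -> GDD g m.
Proof.
move=> <- <- h; apply: (@decomp_bij _ _ _ _ (fun a => (enum_rank a.1, enum_rank a.2)) _ _ _ h).
- by rewrite !card_prod !card_ord.
- by move=> [a b] [a' b'] [/enum_rank_inj -> /enum_rank_inj ->].
- by move=> a b; rewrite (inj_eq enum_rank_inj).
Qed.

End Framework.

(** * Dividing the index by the order of a field *)

(** Number [P] by [C * 'I_l] and colour by the first coordinate; [c0] only serves outside [P]. *)
Lemma uniform_coloring (A C : finType) (c0 : C) (P : {set A}) l :
  #|P| = #|C| * l ->
  exists f : A -> C, forall c, #|[set a in P | f a == c]| = l.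
Proof.
move=> cP; have cc : #|{: C * 'I_l}| = #|P| by rewrite card_prod card_ord cP.
pose g (x : C * 'I_l) : A := enum_val (cast_ord cc (enum_rank x)).
have injg : injective g by move=> x y /enum_val_inj /cast_ord_inj /enum_rank_inj.
have gP x : g x \in P by apply: enum_valP.
pose f a := if [pick x | g x == a] is Some x then x.1 else c0.
have fg x : f (g x) = x.1.
  by rewrite /f; case: pickP => [y /eqP /injg -> //|/(_ x)]; rewrite eqxx.
exists f => c; rewrite -[RHS](card_ord l) -(@card_imset _ _ (fun u => g (c, u))); last first.
  by move=> u v /injg [].
apply: eq_card => a; rewrite inE; apply/idP/imsetP => [/andP[aP /eqP fa]|[u _ ->]]; last first.
  by rewrite gP fg eqxx.
pose x := enum_val (cast_ord (esym cc) (enum_rank_in aP a)).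
have ga : g x = a by rewrite /g /x enum_valK cast_ordKV enum_rankK_in.
have xc : x.1 = c by rewrite -fg ga.
by exists x.2 => //; rewrite -xc -surjective_pairing ga.
Qed.

Section BlowUp.
Local Open Scope ring_scope.
Variables (k : nat) (col : 'I_k -> 'I_k -> bool) (mu : bool -> nat).
Hypothesis col_sym : forall p p', col p p' = col p' p.

Lemma hits_sym (X : eqType) (b : 'I_k -> X) c x y : hits col b c x y = hits col b c y x.
Proof.
rewrite /hits (reindex_inj (h := fun p : 'I_k * 'I_k => (p.2, p.1))) /=; last by move=> [? ?] [? ?] [-> ->].
by apply: eq_big => [p|p _]; rewrite 1?eq_sym 1?col_sym // andbC.
Qed.

Variables (V : finType) (r : rel V) (F : finFieldType) (K : finType).
Variables (iota : option V -> K) (kap : option V -> F).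
Hypotheses (r_irr : irreflexive r) (r_sym : symmetric r).
Hypotheses (iotaI : injective iota) (kapI : injective kap).
Variables (I : finType) (b : I -> 'I_k -> V).
Hypothesis bE : forall c x y, (\sum_i hits col (b i) c x y = #|F| * mu c * r x y)%N.

Let U := {ffun K -> F}.
Let tau (u : K -> F) : F := \sum_q u q.
(** Slopes attached to vertices. At the one coordinate reserved for [x] the slope becomes
    [kap None]: distinct vertices keep distinct slopes everywhere, and the change makes [x]
    detectable by [tau]. *)
Let theta x q : F := kap (if q == iota (Some x) then None else Some x).
Let lt (x y : V) := (enum_rank x < enum_rank y)%N.

Let thetaB x y q : x != y -> theta x q - theta y q != 0.
Proof.
move=> nxy; rewrite subr_eq0 (inj_eq kapI).
case: (q =P iota (Some x)) => [qx|_]; case: (q =P iota (Some y)) => [qy|_] //.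
  by have [exy] := iotaI (etrans (esym qx) qy); rewrite exy eqxx in nxy.
Qed.

(* Two coordinates differing only in the value attached to y isolate y. *)
Let rho x y := ((kap (Some x) - kap None)^-1 - (kap (Some x) - kap (Some y))^-1)^-1.
Let dlt x y q : F :=
  if q == iota (Some y) then rho x y else if q == iota None then - rho x y else 0.

(** The contributions of the two supporting coordinates cancel unless [z = y], whose slope differs
    between them; [rho] then normalises the difference to one. *)
Let tau_dlt x y z : x != y -> x != z ->
  tau (fun q => dlt x y q / (theta x q - theta z q)) = (z == y)%:R.
Proof.
move=> nxy nxz; rewrite /tau (bigD1 (iota (Some y))) //= (bigD1 (iota None)) /=; last first.
  by rewrite (inj_eq iotaI).
rewrite big1 => [|q /andP[/negbTE n1 /negbTE n2]]; last by rewrite /dlt n1 n2 mul0r.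
rewrite addr0 /dlt eqxx !(inj_eq iotaI) /= /theta !(inj_eq iotaI) /=.
have -> : (Some y == Some x) = false by apply/negbTE; rewrite eq_sym.
have -> : (Some y == Some z) = (z == y) by rewrite eq_sym.
case: eqP => [->|_] /=; last by rewrite mulNr subrr.
have n1 : kap (Some x) - kap None != 0 by rewrite subr_eq0 (inj_eq kapI).
have n2 : kap (Some x) - kap (Some y) != 0 by rewrite subr_eq0 (inj_eq kapI).
rewrite mulNr -mulrBr mulVf // subr_eq0 (inj_eq invr_inj) (inj_eq (addrI _)).
by rewrite (inj_eq oppr_inj) (inj_eq kapI).
Qed.

Let A c x y : {set I * ('I_k * 'I_k)} :=
  [set ip | [&& ip.2.1 != ip.2.2, col ip.2.1 ip.2.2 == c,
             b ip.1 ip.2.1 == x & b ip.1 ip.2.2 == y]].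

Let sumA (G : I * ('I_k * 'I_k) -> nat) c x y :
  (\sum_i \sum_(p | (p.1 != p.2) && (col p.1 p.2 == c))
     ((b i p.1 == x) && (b i p.2 == y)) * G (i, p) = \sum_(ip in A c x y) G ip)%N.
Proof.
rewrite pair_big_dep /= big_mkcond [RHS]big_mkcond /=; apply: eq_bigr => -[i p] _ /=.
by rewrite inE /=; do ?case: eqP => //=; rewrite ?mul1n ?mul0n.
Qed.

Let cardA c x y : (#|A c x y| = #|F| * (mu c * r x y))%N.
Proof.
rewrite mulnA -bE -sum1_card -sumA; apply: eq_bigr => i _; apply: eq_bigr => p _.
by rewrite muln1.
Qed.

Let b_inj i : injective (b i).
Proof.
move=> p p' bp; apply/eqP/negP => /negP npp.
suff : (0 < #|A (col p p') (b i p) (b i p)|)%N by rewrite cardA r_irr !muln0.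
by apply/card_gt0P; exists (i, (p, p')); rewrite inE /= npp eqxx bp eqxx.
Qed.

(** Blocks are lifted by adding a vector [a], a translation [s] and the slope times [t], where
    [tau t = 0]. For two given points over [x] and [y], an incidence of a block with this edge has
    one candidate for [s] and [t], and [tau t = 0] prescribes its label in [F]. Labels are
    equidistributed over the [#|F| * mu c] incidences, so [mu c] of them remain. *)
Lemma decomp_blowup : decomp col mu (fun x y : V * U => r x.1 y.1).
Proof.
have /choice [f hf] : forall cxy : bool * V * V, exists f : I * ('I_k * 'I_k) -> F,
    forall v, #|[set a in A cxy.1.1 cxy.1.2 cxy.2 | f a == v]| =
              (mu cxy.1.1 * r cxy.1.2 cxy.2)%N.
  by move=> cxy; apply: uniform_coloring; [exact: 0 | exact: cardA].
pose phi i p p' := f (col p p', b i p, b i p') (i, (p, p')).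
(* Summing over larger vertices only makes the system triangular: the label of a pair is carried by
   its smaller vertex and is not disturbed by the larger one. *)
pose a i p q := \sum_(p' | lt (b i p) (b i p')) phi i p p' * dlt (b i p) (b i p') q.
have ltN x y : lt x y -> x != y by rewrite /lt; apply: contraTneq => ->; rewrite ltnn.
have tauS (J : finType) (P : pred J) (G : J -> F) (h : J -> K -> F) (w : K -> F) :
    tau (fun q => (\sum_(j | P j) G j * h j q) / w q) =
    \sum_(j | P j) G j * tau (fun q => h j q / w q).
  rewrite /tau; under eq_bigr do rewrite mulr_suml.
  rewrite exchange_big /=; apply: eq_bigr => j _; rewrite mulr_sumr.
  by apply: eq_bigr => q _; rewrite mulrA.
have tau_a i p p' : lt (b i p) (b i p') ->
    tau (fun q => (a i p q - a i p' q) / (theta (b i p) q - theta (b i p') q)) = phi i p p'.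
  move=> lpp; have npp := ltN _ _ lpp.
  have -> : phi i p p' =
    tau (fun q => a i p q / (theta (b i p) q - theta (b i p') q)) -
    tau (fun q => a i p' q / (theta (b i p) q - theta (b i p') q)).
    rewrite (tauS _ _ _ _ (fun q => theta (b i p) q - theta (b i p') q)).
    rewrite (bigD1 p') //= tau_dlt // eqxx mulr1 big1 ?addr0.
      have -> : tau (fun q => a i p' q / (theta (b i p) q - theta (b i p') q)) = 0.
        transitivity (- tau (fun q => a i p' q / (theta (b i p') q - theta (b i p) q))).
          rewrite /tau -sumrN; apply: eq_bigr => q _.
          by rewrite -mulrN -invrN opprB.
        rewrite (tauS _ _ _ _ (fun q => theta (b i p') q - theta (b i p) q)).
        rewrite big1 ?oppr0 // => p'' l2; rewrite tau_dlt ?(ltN _ _ l2) 1?eq_sym //.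
        have -> : (b i p'' == b i p) = false; last by rewrite mulr0.
        by apply/negbTE; rewrite eq_sym; apply: ltN; apply: (ltn_trans lpp l2).
      by rewrite subr0.
    move=> p'' /andP[l2 n2]; rewrite tau_dlt ?(ltN _ _ l2) //.
    have -> : (b i p' == b i p'') = false; last by rewrite mulr0.
    by apply/negbTE; rewrite (inj_eq (@b_inj i)) eq_sym.
  by rewrite /tau -sumrB; apply: eq_bigr => q _; rewrite mulrBl.
pose T := {t : U | tau t == 0}.
pose B (ist : I * (U * T)) p : V * U :=
  (b ist.1 p, [ffun q => a ist.1 p q + ist.2.1 q + theta (b ist.1 p) q * sval ist.2.2 q]).
exists (I * (U * T))%type, B.
suff main c x y u u' : lt x y -> (\sum_i hits col (B i) c (x, u) (y, u') = mu c * r x y)%N.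
  move=> c [x u] [y u'] /=.
  case: (ltngtP (enum_rank x) (enum_rank y)) => [|h|/val_inj/enum_rank_inj <-].
  - exact: main.
  - by rewrite r_sym -(main c y x u' u h); apply: eq_bigr => i _; apply: hits_sym.
  rewrite r_irr muln0; apply: big1 => i _; apply: big1 => p /andP[np _].
  rewrite /B !xpair_eqE; case: (b i.1 p.1 =P x) => //= e1.
  case: (b i.1 p.2 =P x) => /= [e2|_]; last by rewrite andbF.
  by move: np; rewrite (@b_inj i.1 p.1 p.2) ?eqxx // e1 e2.
move=> lxy; have nxy := ltN _ _ lxy.
(* This is the label that an incidence must carry; it depends on the two target points only. *)
pose psi := tau (fun q => (u q - u' q) / (theta x q - theta y q)).
rewrite -(hf (c, x, y) psi) /= -sum1_card.
transitivity (\sum_(ip in A c x y) (f (c, x, y) ip == psi))%N; last first.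
  rewrite big_mkcond [RHS]big_mkcond /=; apply: eq_bigr => ip _.
  rewrite [in RHS]in_set; case: (ip \in A c x y) => //=; by case: (_ == psi).
rewrite -sumA.
rewrite -(pair_bigA _ (fun i st => hits col (B (i, st)) c (x, u) (y, u'))) /=.
apply: eq_bigr => i _; rewrite exchange_big /=; apply: eq_bigr => p /andP[np /eqP cp].
case: (b i p.1 =P x) => [e1|n1]; last first.
  by apply: big1 => st _; rewrite xpair_eqE; case: eqP n1.
case: (b i p.2 =P y) => [e2|n2]; last first.
  rewrite /=; apply: big1 => st _; rewrite andbC xpair_eqE; case: eqP n2 => //=.
rewrite /= mul1n.
have tA := tau_a i p.1 p.2; rewrite e1 e2 in tA; have {}tA := tA lxy.
rewrite /phi cp e1 e2 -surjective_pairing in tA; rewrite -tA {tA}.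
pose t0 : U := [ffun q => ((u q - u' q) - (a i p.1 q - a i p.2 q)) / (theta x q - theta y q)].
pose s0 : U := [ffun q => u q - a i p.1 q - theta x q * t0 q].
have tau_t0 : tau t0 = psi - tau (fun q => (a i p.1 q - a i p.2 q) / (theta x q - theta y q)).
  by rewrite /psi /tau -sumrB; apply: eq_bigr => q _; rewrite ffunE mulrBl.
have key st : ((B (i, st) p.1 == (x, u)) && (B (i, st) p.2 == (y, u'))) =
              ((st.1 == s0) && (sval st.2 == t0)).
  rewrite /B !xpair_eqE e1 e2 !eqxx /=; apply/andP/andP => -[/eqP h1 /eqP h2].
    have et : sval st.2 = t0.
      apply/ffunP => q; move/ffunP/(_ q): h1; move/ffunP/(_ q): h2; rewrite !ffunE /= ?e1 ?e2 => <- <-.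
      have n0 := thetaB q nxy; apply: (mulIf n0); rewrite mulfVK //; ring.
    split; apply/eqP => //; apply/ffunP => q; rewrite ffunE -et.
    by move/ffunP/(_ q): h1; rewrite !ffunE /= ?e1 => <-; ring.
  rewrite h1 h2; split; apply/eqP/ffunP => q; rewrite !ffunE ?e1 ?e2.
    by ring.
  have n0 := thetaB q nxy; by field.
under eq_bigr do rewrite key.
rewrite eq_sym -subr_eq0 -tau_t0; case: (boolP (tau t0 == 0)) => [h0|h0].
  rewrite (bigD1 (s0, Sub t0 h0 : T)) //= !eqxx big1 // => -[s t] /=.
  by rewrite xpair_eqE -val_eqE /= => /negbTE ->.
apply: big1 => -[s t] _ /=; case: eqP => //= _; case: eqP => // et.
by have := svalP t; rewrite /= et (negbTE h0).
Qed.

End BlowUp.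

(** * Integral combinations of blocks *)

Section Span.
Local Open Scope ring_scope.
Variables (M : zmodType) (B : finType) (cov : B -> M).

Definition int_span : {pred M} :=
  [pred f | `[< exists z : B -> int, f = \sum_b cov b *~ z b >]].

Lemma int_spanP f : reflect (exists z : B -> int, f = \sum_b cov b *~ z b) (f \in int_span).
Proof. exact: asboolP. Qed.

Lemma int_span_zmod_closed : zmod_closed int_span.
Proof.
split=> [|f g /int_spanP[z ->] /int_spanP[w ->]]; apply/int_spanP.
  by exists (fun=> 0); rewrite big1 // => b _; rewrite mulr0z.
exists (fun b => z b - w b); rewrite -sumrB; apply: eq_bigr => b _.
by rewrite mulrzBr.
Qed.

HB.instance Definition _ := GRing.isZmodClosed.Build M int_span int_span_zmod_closed.

(* A vector killed by every homomorphism that kills the generators is an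
   integral combination of them: test it on the quotient group. *)
Lemma int_span_annihilator (t : M) :
  (forall (G : zmodType) (phi : {additive M -> G}),
     (forall b, phi (cov b) = 0) -> phi t = 0) ->
  exists z : B -> int, t = \sum_b cov b *~ z b.
Proof.
move=> h; apply/int_spanP; pose Q := Quotient.quot int_span.
have covL b : cov b \in int_span.
  apply/int_spanP; exists (fun b' => (b' == b)%:R).
  rewrite (bigD1 b) //= eqxx big1 ?addr0 // => b' /negbTE ->; exact: mulr0z.
have pi0 f : (f \in int_span) = (\pi_Q f == 0 :> Q)%qT.
  by rewrite -[0]pi_zeror -Quotient.idealrBE subr0.
rewrite pi0; apply/eqP; apply: (h Q (\pi_Q)%qT) => b.
by apply/eqP; rewrite -pi0.
Qed.
End Span.

Lemma big_half (R : Type) (idx : R) (op : Monoid.com_law idx) (T : finType)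
    (P : rel T) (rk : T -> nat) (f : T -> T -> R) :
  injective rk -> symmetric P ->
  \big[op/idx]_(x : T * T | (x.1 != x.2) && P x.1 x.2) f x.1 x.2 =
  \big[op/idx]_(x : T * T | (rk x.1 < rk x.2)%N && P x.1 x.2) op (f x.1 x.2) (f x.2 x.1).
Proof.
move=> rkI Ps; rewrite big_split /=.
rewrite [X in op _ X](reindex_inj (h := fun p : T * T => (p.2, p.1))) /=; last by move=> [? ?] [? ?] [-> ->].
rewrite (bigID (fun x : T * T => rk x.1 < rk x.2)%N) /=; congr (op _ _).
  apply: eq_bigl => -[x y] /=; rewrite -(inj_eq rkI).
  by case: ltngtP => //=; rewrite ?andbF ?andbT.
apply: eq_bigl => -[x y] /=; rewrite -(inj_eq rkI) Ps.
by case: ltngtP => //=; rewrite ?andbF ?andbT.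
Qed.

(** * The two-coloured block of a nesting and its pair counts *)

Definition nest_col (k1 k2 : nat) (p p' : 'I_k2) := (p < k1) && (p' < k1).
(** A pair lies in [l2] blocks and in [l1] distinguished subsets, which leaves [l2 - l1] for the
    other colour; [nest_lambda_le] shows that nothing is truncated. *)
Definition nest_mu (l1 l2 : nat) (c : bool) := if c then l1 else l2 - l1.

Lemma nest_col_sym k1 k2 p p' : @nest_col k1 k2 p p' = nest_col k1 p' p.
Proof. exact: andbC. Qed.

Definition npairs (k1 k2 : nat) c :=
  \sum_(p : 'I_k2 * 'I_k2 | (p.1 != p.2) && (nest_col k1 p.1 p.2 == c)) 1.

Lemma card_lt_ord (k1 k2 : nat) : k1 <= k2 -> #|[pred p : 'I_k2 | p < k1]| = k1.
Proof.
move=> h; rewrite -[RHS](card_ord k1) -(card_image (f := widen_ord h)) ?card_ord; last first.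
  by move=> x y /(congr1 val) /= /val_inj.
apply: eq_card => p; rewrite inE; apply/idP/imageP => [pk|[q _ ->]]; last exact: (ltn_ord q).
by exists (Ordinal pk) => //; apply: val_inj.
Qed.

Lemma npairs_true k1 k2 : k1 <= k2 -> npairs k1 k2 true = k1 * (k1 - 1).
Proof.
move=> h; rewrite /npairs.
rewrite (eq_bigl (fun p : 'I_k2 * 'I_k2 => (p.1 < k1) && ((p.2 != p.1) && (p.2 < k1)))); last first.
  by move=> [p q] /=; rewrite eqb_id /nest_col eq_sym; case: (_ != _); rewrite /= ?andbF.
rewrite -(pair_big_dep (fun p : 'I_k2 => p < k1) (fun p q : 'I_k2 => (q != p) && (q < k1)) (fun _ _ => 1)) /=.
rewrite (eq_bigr (fun=> k1 - 1)) => [|p pk].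
  by rewrite sum_nat_const card_lt_ord.
rewrite sum1_card; have := cardD1 p [pred q : 'I_k2 | q < k1].
rewrite card_lt_ord // inE pk => e; rewrite [X in X - 1]e /= addKn.
by apply: eq_card => q; rewrite !inE.
Qed.

Lemma npairs_sum k1 k2 : npairs k1 k2 true + npairs k1 k2 false = k2 * (k2 - 1).
Proof.
rewrite -(@npairs_true k2 k2) // /npairs [RHS](bigID (fun p => nest_col k1 p.1 p.2 == true)) /=.
have colT p q : @nest_col k2 k2 p q = true by rewrite /nest_col !ltn_ord.
by congr (_ + _); apply: eq_bigl => -[p q] /=; rewrite colT; case: (nest_col k1 p q); case: (p != q).
Qed.

Lemma nest_lambda_le k1 k2 l1 l2 : 1 < k1 -> k1 < k2 ->
  l1 * (k2 * (k2 - 1)) = l2 * (k1 * (k1 - 1)) -> l1 <= l2.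
Proof.
move=> k1_gt1 k12 l_eq.
have hA : 0 < k1 * (k1 - 1) by rewrite muln_gt0; lia.
have hAB : k1 * (k1 - 1) <= k2 * (k2 - 1) by apply: leq_mul; lia.
by rewrite -(leq_pmul2r hA) -l_eq leq_mul2l hAB orbT.
Qed.

(** The relation between the indices makes [mu] proportional to the numbers of pairs of each colour,
    so a family treating all pairs alike has multiplicities proportional to [mu]. *)
Lemma nest_mu_npairs k1 k2 l1 l2 c : 1 < k1 -> k1 < k2 ->
  l1 * (k2 * (k2 - 1)) = l2 * (k1 * (k1 - 1)) ->
  l1 * npairs k1 k2 c = nest_mu l1 l2 c * (k1 * (k1 - 1)).
Proof.
move=> k1_gt1 k12 l_eq.
have := npairs_sum k1 k2; have := l_eq; have := @npairs_true k1 k2 (ltnW k12); have := nest_lambda_le k1_gt1 k12 l_eq.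
case: c => /= h1 -> // h2 h3; rewrite mulnBl -h2 -h3 mulnDr; lia.
Qed.

(** * Cliques in complete multipartite graphs *)

Section Multipartite.
Variables (k2 m s : nat).
Local Notation V := ('I_m * 'I_s)%type.
Definition adj (x y : V) := x.1 != y.1.
Definition clique (b : 'I_k2 -> V) := [forall p, forall p', (p != p') ==> adj (b p) (b p')].

Lemma adj_sym : symmetric adj. Proof. by move=> x y; rewrite /adj eq_sym. Qed.
Lemma adj_irr : irreflexive adj. Proof. by move=> x; rewrite /adj eqxx. Qed.

Lemma cliqueP b : reflect (forall p p', p != p' -> adj (b p) (b p')) (clique b).
Proof.
apply: (iffP forallP) => h p; first by move=> p'; have /forallP/(_ p')/implyP := h p.
by apply/forallP => p'; apply/implyP/h.
Qed.

Hypotheses (m_ge : k2 + 4 <= m) (s_gt0 : 0 < s).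

Lemma exists_part (A : seq 'I_m) : size A < m -> exists a, a \notin A.
Proof.
move=> h; have /subsetPn [a _ aA] : ~~ ([set: 'I_m] \subset A).
  apply/negP => /subset_leq_card; rewrite cardsT card_ord => h'.
  by have := leq_ltn_trans (leq_trans h' (card_size A)) h; rewrite ltnn.
by exists a.
Qed.

Lemma exists_nbr (A : seq V) : size A < m -> exists z, forall x, x \in A -> adj x z.
Proof.
move=> h; have [|a aA] := exists_part (A := [seq x.1 | x <- A]); first by rewrite size_map.
exists (a, Ordinal s_gt0) => x xA; rewrite /adj /=.
by apply: contraNneq aA => <-; apply: map_f.
Qed.

(** The vertices of [A] meet at most four parts, which leaves [k2] parts free; hence the bound
    [k2 + 4 <= m]. *)
Lemma exists_clique (A : seq V) : size A <= 4 ->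
  exists b : 'I_k2 -> V, clique b /\ forall p x, x \in A -> adj x (b p).
Proof.
move=> hA; pose P := [pred a : 'I_m | a \notin [seq x.1 | x <- A]].
have cP : k2 <= #|P|.
  have := cardC [pred a | a \in [seq x.1 | x <- A]]; rewrite card_ord.
  have := card_size [seq x.1 | x <- A]; rewrite size_map.
  have -> : #|[predC [pred a | a \in [seq x.1 | x <- A]]]| = #|P| by apply: eq_card.
  have -> : #|[pred a | a \in [seq x.1 | x <- A]]| = #|[seq x.1 | x <- A]| by apply: eq_card.
  lia.
exists (fun p => (enum_val (widen_ord cP p), Ordinal s_gt0)); split.
  apply/cliqueP => p p' npp; rewrite /adj /= (inj_eq enum_val_inj).
  by apply: contra npp => /eqP /(congr1 val) /= /val_inj ->.
move=> p x xA; have := enum_valP (widen_ord cP p); rewrite inE /adj /=.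
by apply: contra => /eqP <-; apply: map_f.
Qed.

End Multipartite.

(** * Homomorphisms that vanish on every block *)

Section Algebra.
Variables (k1 k2 l1 l2 m s : nat).
Hypotheses (k1_gt1 : 1 < k1) (k12 : k1 < k2) (l1_gt0 : 0 < l1).
Hypothesis l_eq : l1 * (k2 * (k2 - 1)) = l2 * (k1 * (k1 - 1)).
Hypotheses (m_ge : k2 + 4 <= m) (s_gt0 : 0 < s).

Local Notation col := (@nest_col k1 k2).
Local Notation mu := (nest_mu l1 l2).
Local Notation V := ('I_m * 'I_s)%type.
Local Notation adj := (@adj m s).

Section Group.
Local Open Scope ring_scope.
Variables (G : zmodType) (E : bool -> V -> V -> G).
Hypothesis Eblock : forall b, clique b ->
  \sum_(p : 'I_k2 * 'I_k2 | p.1 != p.2) E (col p.1 p.2) (b p.1) (b p.2) = 0.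

Let e c x y := E c x y + E c y x.
Let e_sym c x y : e c x y = e c y x. Proof. exact: addrC. Qed.

Let upd (b : 'I_k2 -> V) p x q := if q == p then x else b q.

Let clique_upd b p x : clique b -> (forall q, q != p -> adj x (b q)) -> clique (upd b p x).
Proof.
move=> /cliqueP cb cx; apply/cliqueP => q q' nq; rewrite /upd.
case: (q =P p) => [eq|nqp]; case: (q' =P p) => [eq'|nqp'].
- by rewrite eq eq' eqxx in nq.
- by apply: cx; apply/eqP.
- by rewrite adj_sym; apply: cx; apply/eqP.
- exact: cb.
Qed.

(** Take four blocks agreeing outside two positions, with [x] or [x'] at one and [y] or [y'] at the
    other. In their alternating sum only the pair formed by these positions survives. *)
Let square c x x' y y' : adj x y -> adj x' y -> adj x y' -> adj x' y' ->
  e c x y - e c x' y = e c x y' - e c x' y'.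
Proof.
move=> xy x'y xy' x'y'.
have k2_gt0 : (0 < k2)%N by lia.
have k2_gt1 : (1 < k2)%N by lia.
have [p [p' [npp cpp]]] : exists p p' : 'I_k2, p != p' /\ col p p' = c.
  case: c; first by exists (Ordinal k2_gt0), (Ordinal k2_gt1); split=> //; rewrite /nest_col /=; lia.
  have l : (k2.-1 < k2)%N by lia.
  exists (Ordinal k2_gt0), (Ordinal l); split; rewrite -?val_eqE /nest_col /=; lia.
have [b [cb bA]] := exists_clique m_ge s_gt0 (A := [:: x; x'; y; y']) isT.
have bA' q z : z \in [:: x; x'; y; y'] -> adj z (b q) by apply: bA.
pose B z w := upd (upd b p z) p' w.
have cB z w : adj z w -> z \in [:: x; x'] -> w \in [:: y; y'] -> clique (B z w).
  move=> zw hz hw; apply: clique_upd; first apply: clique_upd => //.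
  - by move=> q _; apply: bA'; move: hz; rewrite !inE => /orP[] ->; rewrite ?orbT.
  - move=> q _; rewrite /upd; case: eqP => _; first by rewrite adj_sym.
    by apply: bA'; move: hw; rewrite !inE => /orP[] ->; rewrite ?orbT.
pose T z w (q : 'I_k2 * 'I_k2) := E (col q.1 q.2) (B z w q.1) (B z w q.2).
have S0 : \sum_(q : 'I_k2 * 'I_k2 | q.1 != q.2) (T x y q - T x' y q - T x y' q + T x' y' q) = 0.
  rewrite big_split /= 2!sumrB /T !Eblock ?subr0 ?addr0 //; apply: cB => //; by rewrite !inE eqxx ?orbT.
have Bp z w : B z w p = z by rewrite /B /upd eqxx (negbTE npp).
have Bp' z w : B z w p' = w by rewrite /B /upd eqxx.
have Bq z w q : q != p -> q != p' -> B z w q = b q.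
  by rewrite /B /upd => /negbTE -> /negbTE ->.
have ccp : col p' p = c by rewrite nest_col_sym.
move: S0; rewrite (bigD1 (p, p')) //= (bigD1 (p', p)) /=; last first.
  by rewrite eq_sym npp xpair_eqE negb_and eq_sym npp.
rewrite big1 => [|[q q'] /= /andP[/andP[nq n1] n2]].
  rewrite /T /= !Bp !Bp' cpp ccp addr0 /e => h; apply/eqP; rewrite -subr_eq0; apply/eqP.
  by rewrite -[RHS]h !opprD !opprK !addrA [RHS](ACl (1*5*2*6*3*7*4*8)).
have [qp|nqp] := eqVneq q p; last have [qp'|nqp'] := eqVneq q p'.
- rewrite qp in nq n1 n2 *; rewrite eq_sym in nq; have nq' : q' != p' by move: n1; rewrite xpair_eqE eqxx.
  by rewrite /T /= !Bp !Bq // addrAC subrK subrr.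
- rewrite qp' in nq n1 n2 *; rewrite eq_sym in nq; have nq' : q' != p by move: n2; rewrite xpair_eqE eqxx.
  by rewrite /T /= !Bp' !Bq // subrr sub0r addNr.
rewrite /T /= !(Bq _ _ q) //.
have [qp2|nqp2] := eqVneq q' p; first by rewrite qp2 !Bp addrAC subrK subrr.
have [qp2'|nqp2'] := eqVneq q' p'; first by rewrite qp2' !Bp' subrr sub0r addNr.
by rewrite !Bq // subrr sub0r addNr.
Qed.

Let m_gt0 : (0 < m)%N. Proof. by lia. Qed.
Let r0 : V := (Ordinal m_gt0, Ordinal s_gt0).

Let zz_ex x : exists z, adj x z && adj r0 z.
Proof.
have [|z hz] := exists_nbr s_gt0 (A := [:: x; r0]); first by rewrite /=; lia.
by exists z; rewrite !hz // !inE eqxx ?orbT.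
Qed.
Let zz x := xchoose (zz_ex x).
(** A potential for [e] with base point [r0]: by [square], the difference is the same for every
    common neighbour of [x] and [r0]. *)
Let D c x := e c x (zz x) - e c r0 (zz x).

Let DE c x z : adj x z -> adj r0 z -> D c x = e c x z - e c r0 z.
Proof.
move=> xz rz; have /andP[h1 h2] := xchooseP (zz_ex x).
exact: square.
Qed.

Let D0 c : D c r0 = 0. Proof. exact: subrr. Qed.

Let e_step c x x' y : adj x y -> adj x' y -> e c x y - e c x' y = D c x - D c x'.
Proof.
move=> xy x'y; have [|z hz] := exists_nbr s_gt0 (A := [:: x; x'; r0]); first by rewrite /=; lia.
have [xz x'z rz] : [/\ adj x z, adj x' z & adj r0 z].
  by split; apply: hz; rewrite !inE eqxx ?orbT.
rewrite (square c xy x'y xz x'z) (DE c xz rz) (DE c x'z rz).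
by rewrite opprB addrA subrK.
Qed.

Let r1 := zz r0.
Let r01 : adj r0 r1. Proof. by have /andP[] := xchooseP (zz_ex r0). Qed.
Let kap c := e c r0 r1 - D c r1.

(** The edge is moved to the base edge [r0], [r1] one endpoint at a time, through a common neighbour
    [w] of [x] and [r0]. *)
Let e_form c x y : adj x y -> e c x y = D c x + D c y + kap c.
Proof.
move=> xy; have [|w hw] := exists_nbr s_gt0 (A := [:: x; r0]); first by rewrite /=; lia.
have [xw rw] : adj x w /\ adj r0 w by split; apply: hw; rewrite !inE eqxx ?orbT.
have h1 : e c x y = D c y - D c w + e c x w.
  by apply/eqP; rewrite -subr_eq e_sym (e_sym c x w) e_step // adj_sym.
have h2 : e c x w = D c x + e c r0 w.
  by apply/eqP; rewrite -subr_eq e_step // D0 subr0.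
have h3 : e c r0 w = D c w - D c r1 + e c r0 r1.
  by apply/eqP; rewrite -subr_eq e_sym (e_sym c r0 r1) e_step // adj_sym.
rewrite h1 h2 h3 /kap; move: (D c x) (D c y) (D c w) (D c r1) (e c r0 r1) => a1 a2 a3 a4 a5.
by rewrite !addrA [LHS](ACl (3*1*6*5*4*2)) /= addrK.
Qed.

Let blockD b : clique b ->
  \sum_(p : 'I_k2 * 'I_k2 | p.1 != p.2) D (col p.1 p.2) (b p.1) +
  \sum_(p : 'I_k2 * 'I_k2 | (p.1 < p.2)%N) kap (col p.1 p.2) = 0.
Proof.
move=> cb; rewrite -[RHS](Eblock cb).
have half f : \sum_(p : 'I_k2 * 'I_k2 | p.1 != p.2) f p.1 p.2 =
   \sum_(p : 'I_k2 * 'I_k2 | (p.1 < p.2)%N) (f p.1 p.2 + f p.2 p.1) :> G.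
  have := @big_half G 0 +%R 'I_k2 (fun _ _ => true) val f val_inj (fun _ _ => erefl).
  by rewrite !(eq_bigl _ _ (fun p => andbT _)).
rewrite (half (fun p p' => D (col p p') (b p))) (half (fun p p' => E (col p p') (b p) (b p'))).
rewrite -big_split /=; apply: eq_bigr => -[p q] /= pq.
rewrite (nest_col_sym k1 q p) -e_form //; apply: (cliqueP _ cb).
by rewrite -val_eqE /= neq_ltn pq.
Qed.

(** Two blocks differing only in the vertex at position [p] both satisfy [blockD], so the sum is the
    same at all vertices, and it vanishes at [r0]. *)
Let posD p x : \sum_(q | q != p) D (col p q) x = 0.
Proof.
suff h x' : \sum_(q | q != p) D (col p q) x = \sum_(q | q != p) D (col p q) x'.
  by rewrite (h r0) big1.
have [b [cb bA]] := exists_clique m_ge s_gt0 (A := [:: x; x']) isT.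
have cu z : z \in [:: x; x'] -> clique (upd b p z).
  by move=> hz; apply: clique_upd => // q _; apply: bA.
have sumE z : \sum_(q : 'I_k2 * 'I_k2 | q.1 != q.2) D (col q.1 q.2) (upd b p z q.1) =
    \sum_(q | q != p) D (col p q) z +
    \sum_(q : 'I_k2 * 'I_k2 | (q.1 != q.2) && (q.1 != p)) D (col q.1 q.2) (b q.1).
  rewrite (bigID (fun q : 'I_k2 * 'I_k2 => q.1 == p)) /=; congr (_ + _); last first.
    by apply: eq_bigr => q /andP[_ /negbTE nq]; rewrite /upd nq.
  rewrite (eq_bigl (fun q : 'I_k2 * 'I_k2 => (q.1 == p) && (q.2 != q.1))); last first.
    by move=> q; rewrite andbC eq_sym (eq_sym q.1).
  rewrite -(pair_big_dep (fun q => q == p) (fun q q' => q' != q) (fun q q' => D (col q q') (upd b p z q))) /=.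
  by rewrite big_pred1_eq; apply: eq_bigr => q _; rewrite /upd eqxx.
have := blockD (cu x' _); have := blockD (cu x _); rewrite !sumE !inE !eqxx orbT => h1 h2.
have := etrans (h1 isT) (esym (h2 isT)); rewrite -!addrA; exact: addIr.
Qed.

Let k2_gt0 : (0 < k2)%N. Proof. by lia. Qed.
Let k2_last : (k2.-1 < k2)%N. Proof. by lia. Qed.

(** The last position is not among the first [k1], so all its pairs have colour [false]. *)
Let D_false x : D false x *+ (k2 - 1) = 0.
Proof.
rewrite -[RHS](posD (Ordinal k2_last) x) (eq_bigr (fun=> D false x)); last first.
  by move=> q _; congr (D _ _); rewrite /nest_col /=; lia.
by rewrite sumr_const cardC1 card_ord subn1.
Qed.

Let D_true x : D true x *+ (k1 - 1) + D false x *+ (k2 - k1) = 0.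
Proof.
rewrite -[RHS](posD (Ordinal k2_gt0) x) (bigID (fun q : 'I_k2 => (q < k1)%N)) /=.
rewrite (eq_bigr (fun=> D true x)) => [|q /andP[_ qk]]; last by rewrite /nest_col qk /= (ltnW k1_gt1).
rewrite [X in _ = _ + X](eq_bigr (fun=> D false x)) => [|q /andP[_ /negbTE qk]]; last by rewrite /nest_col qk andbF.
rewrite !sumr_const; congr (_ *+ _ + _ *+ _).
  have := cardD1 (Ordinal k2_gt0) [pred q : 'I_k2 | (q < k1)%N].
  rewrite (card_lt_ord (ltnW k12)) inE /= (ltnW k1_gt1) => h; rewrite {1}h addKn.
  by apply: eq_card => q; rewrite !inE.
have := cardC [pred q : 'I_k2 | (q < k1)%N]; rewrite (card_lt_ord (ltnW k12)) card_ord => h.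
rewrite -[X in (X - _)%N]h addKn; apply: eq_card => q.
by rewrite !inE unfold_in -val_eqE /=; lia.
Qed.

Let hh c := (\sum_(p : 'I_k2 * 'I_k2 | (p.1 < p.2)%N && (col p.1 p.2 == c)) 1)%N.

Let hhE c : (npairs k1 k2 c = 2 * hh c)%N.
Proof.
rewrite /npairs (big_half addn (P := fun p p' : 'I_k2 => nest_col k1 p p' == c) (fun _ _ => 1%N) val_inj).
  by rewrite /hh big_distrr.
by move=> p q; rewrite nest_col_sym.
Qed.

(** Summing [posD] over all positions removes the potentials from [blockD]. *)
Let kap_rel : kap true *+ hh true + kap false *+ hh false = 0.
Proof.
have [b [cb _]] := exists_clique m_ge s_gt0 (A := [::]) isT.
rewrite -[RHS](blockD cb) [X in _ = X + _](_ : _ = 0) ?add0r; last first.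
  rewrite (eq_bigl (fun q : 'I_k2 * 'I_k2 => true && (q.2 != q.1))); last first.
    by move=> q; rewrite eq_sym.
  rewrite -(pair_big_dep xpredT (fun q q' => q' != q) (fun q q' => D (col q q') (b q))) /=.
  by rewrite big1 // => p _; apply: posD.
rewrite [RHS](bigID (fun p : 'I_k2 * 'I_k2 => col p.1 p.2 == true)) /=; congr (_ + _).
  rewrite (eq_bigr (fun=> kap true)) => [|p /andP[_ /eqP ->]] //.
  by rewrite sumr_const /hh sum1_card.
rewrite (eq_bigl (fun p : 'I_k2 * 'I_k2 => (p.1 < p.2)%N && (col p.1 p.2 == false))); last first.
  by move=> p /=; case: (col _ _).
rewrite (eq_bigr (fun=> kap false)) => [|p /andP[_ /eqP ->]] //.
by rewrite sumr_const /hh sum1_card.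
Qed.

Let rk (x : V) : nat := enum_rank x.
Let rkI : injective rk. Proof. by move=> x y /val_inj /enum_rank_inj. Qed.
Let nE := (\sum_(x : V * V | (rk x.1 < rk x.2)%N && adj x.1 x.2) 1)%N.

Let deg x : (\sum_(y | adj x y) 1 = (m - 1) * s)%N.
Proof.
rewrite (eq_bigl (fun y : V => (y.1 != x.1) && true)); last by move=> y; rewrite /adj eq_sym andbT.
rewrite -(pair_big_dep (fun a => a != x.1) (fun _ _ => true) (fun _ _ => 1%N)) /=.
rewrite (eq_bigr (fun=> s)) => [|a _]; last by rewrite sum1_card card_ord.
by rewrite sum_nat_const cardC1 card_ord subn1.
Qed.

Let nadj : (forall x y, (x != y) && adj x y = adj x y).
Proof. by move=> x y; case: eqP => //= ->; rewrite adj_irr. Qed.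

Let nEE : (m * s * ((m - 1) * s) = 2 * nE)%N.
Proof.
transitivity (\sum_(x : V * V | (x.1 != x.2) && adj x.1 x.2) 1)%N.
  rewrite (eq_bigl (fun x : V * V => true && adj x.1 x.2)); last by move=> x; rewrite nadj.
  rewrite -(pair_big_dep xpredT adj (fun _ _ => 1%N)) /= (eq_bigr (fun=> (m - 1) * s)%N) //.
  by rewrite sum_nat_const card_prod !card_ord.
by rewrite (big_half addn (fun _ _ => 1%N) rkI (@adj_sym m s)) /nE big_distrr.
Qed.

Hypotheses (dv1 : (k1 - 1 %| l1 * ((m - 1) * s))%N) (dv2 : (k2 - 1 %| l2 * ((m - 1) * s))%N).
Hypothesis dv3 : (k1 * (k1 - 1) %| l1 * (m * s * ((m - 1) * s)))%N.

(** By [e_form] the sum splits into potentials and constants. The degree conditions [dv1] and [dv2]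
    kill the potentials at each vertex through [D_true] and [D_false]; the edge count [dv3] turns
    the constants into a multiple of [kap_rel]. *)
Lemma edges_vanish : \sum_c (\sum_(x : V * V | adj x.1 x.2) E c x.1 x.2) *+ mu c = 0.
Proof.
have sumE c : \sum_(x : V * V | adj x.1 x.2) E c x.1 x.2 =
    \sum_x D c x *+ ((m - 1) * s) + kap c *+ nE.
  rewrite (eq_bigl (fun x : V * V => (x.1 != x.2) && adj x.1 x.2)); last by move=> x; rewrite nadj.
  rewrite (big_half +%R (E c) rkI (@adj_sym m s)) (eq_bigr (fun x => D c x.1 + D c x.2 + kap c)); last first.
    by move=> x /andP[_ xa]; rewrite -e_form.
  rewrite big_split /= sumr_const -sum1_card; congr (_ + _).
  rewrite -(big_half +%R (fun x _ => D c x) rkI (@adj_sym m s)).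
  rewrite (eq_bigl (fun x : V * V => true && adj x.1 x.2)); last by move=> x; rewrite nadj.
  rewrite -(pair_big_dep xpredT adj (fun x _ => D c x)) /=; apply: eq_bigr => x _.
  by rewrite sumr_const -sum1_card deg.
rewrite big_bool /= !sumE; have := kap_rel; move: (kap true) (kap false) => kt kf kr.
rewrite !mulrnDl -!sumrMnl addrACA -big_split /= big1 ?add0r => [|x _]; last first.
  move/dvdnP: dv1 => [t1 e1]; move/dvdnP: dv2 => [t2 e2].
  rewrite -!mulrnA (mulnC _ l1) e1.
  have h1 : D true x *+ (t1 * (k1 - 1)) + D false x *+ (t1 * (k2 - k1)) = 0.
    by rewrite !(mulnC t1) !mulrnA -mulrnDl D_true mul0rn.
  have Df t : D false x *+ (t * (k2 - 1)) = 0 by rewrite mulnC mulrnA D_false mul0rn.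
  (* By [D_false] only the residue of the multiplier modulo [k2 - 1] matters, and the two
     multipliers agree there. *)
  have h2 : D false x *+ ((m - 1) * s * (l2 - l1)) = D false x *+ (t1 * (k2 - k1)).
    apply: (addIr (D false x *+ (t1 * (k2 - 1)))); rewrite -mulrnDr.
    have -> : ((m - 1) * s * (l2 - l1) + t1 * (k2 - 1) = t1 * (k2 - k1) + t2 * (k2 - 1))%N.
      rewrite mulnBr (mulnC _ l2) (mulnC _ l1) e1 e2.
      have le : (t1 * (k1 - 1) <= t2 * (k2 - 1))%N by rewrite -e1 -e2 leq_mul2r (nest_lambda_le k1_gt1 k12 l_eq) orbT.
      have -> : (t1 * (k2 - 1) = t1 * (k2 - k1) + t1 * (k1 - 1))%N by rewrite -mulnDr; congr muln; clear -k1_gt1 k12; lia.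
      by rewrite addnCA subnK.
    by rewrite !mulrnDr !Df.
  by rewrite h2.
rewrite -!mulrnA; move/dvdnP: dv3 => [N eN].
have hN c : (nE * mu c = N * hh c)%N.
  have A0 : (0 < 2 * (k1 * (k1 - 1)))%N by rewrite !muln_gt0; lia.
  apply/eqP; rewrite -(eqn_pmul2r A0); apply/eqP.
  have := nest_mu_npairs c k1_gt1 k12 l_eq; rewrite hhE => h.
  have -> : (nE * mu c * (2 * (k1 * (k1 - 1))) = 2 * nE * (mu c * (k1 * (k1 - 1))))%N by ring.
  rewrite -h -nEE mulnCA mulnA eN; ring.
rewrite (hN true : nE * l1 = _)%N (hN false : nE * (l2 - l1) = _)%N.
by rewrite !(mulnC N) !mulrnA -mulrnDl kr mul0rn.
Qed.

End Group.
End Algebra.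

(** * Nonnegative combinations *)

Lemma perm_two_transitive (T : finType) (x y x' y' : T) : x != y -> x' != y' ->
  exists g : T -> T, [/\ injective g, g x = x' & g y = y'].
Proof.
move=> nxy nxy'; exists (tperm (tperm x x' y) y' \o tperm x x').
split; first by move=> u v /perm_inj /perm_inj.
  rewrite /= tpermL tpermD //; last by rewrite eq_sym.
  by rewrite -{2}(tpermL x x') (inj_eq perm_inj) eq_sym.
by rewrite /= tpermL.
Qed.

Section Positive.
Variables (k1 k2 l1 l2 m s : nat).
Hypotheses (k1_gt1 : 1 < k1) (k12 : k1 < k2) (l1_gt0 : 0 < l1).
Hypothesis l_eq : l1 * (k2 * (k2 - 1)) = l2 * (k1 * (k1 - 1)).
Hypotheses (m_ge : k2 + 4 <= m) (s_gt0 : 0 < s).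

Local Notation col := (@nest_col k1 k2).
Local Notation mu := (nest_mu l1 l2).
Local Notation V := ('I_m * 'I_s)%type.
Local Notation blk := {ffun 'I_k2 -> V}.
Local Notation adj := (@adj m s).

Let cnt p p' x y := #|[set b : blk | [&& clique b, b p == x & b p' == y]]|.

Let adj_transitive x y x' y' : adj x y -> adj x' y' ->
  exists g : V -> V, [/\ injective g, forall u v, adj (g u) (g v) = adj u v, g x = x' & g y = y'].
Proof.
case: x y x' y' => [x1 x2] [y1 y2] [x1' x2'] [y1' y2']; rewrite /adj /= => nxy nxy'.
have [g [gI gx gy]] := perm_two_transitive nxy nxy'.
pose sh (a : 'I_m) : {perm 'I_s} :=
  if a == x1 then tperm x2 x2' else if a == y1 then tperm y2 y2' else 1%g.
exists (fun u => (g u.1, sh u.1 u.2)); split => [[u1 u2] [v1 v2] /= [/gI -> /perm_inj -> //]|u v /=| /= |/=].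
- by rewrite (inj_eq gI).
- by rewrite gx /sh eqxx tpermL.
- by rewrite gy /sh eq_sym (negbTE nxy) eqxx tpermL.
Qed.

(** A graph automorphism matches the edges and a permutation of positions matches the positions;
    together they inject one set of cliques into the other. Exchanging the roles shows that the
    count is constant. *)
Let cnt_le p p' x y q q' x' y' : p != p' -> q != q' -> adj x y -> adj x' y' ->
  cnt p p' x y <= cnt q q' x' y'.
Proof.
move=> np nq xy xy'; have [g [gI ga gx gy]] := adj_transitive xy xy'.
have [h [hI hq hq']] := perm_two_transitive nq np.
pose f (b : blk) : blk := [ffun q => g (b (h q))].
have fI : injective f.
  move=> b b' /ffunP e; apply/ffunP => r; have [r' rE] : exists r', r = h r'.
    by have /imageP [r' _ rE] : r \in codom h by [apply: inj_card_onto]; exists r'.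
  by have := e r'; rewrite !ffunE -rE => /gI.
rewrite /cnt -(card_imset _ fI); apply: subset_leq_card; apply/subsetP => _ /imsetP[b bP ->].
move: bP; rewrite !inE => /and3P[/cliqueP cb /eqP bx /eqP by_].
rewrite !ffunE hq hq' bx by_ gx gy !eqxx !andbT; apply/cliqueP => r r' nr.
by rewrite !ffunE ga; apply: cb; rewrite (inj_eq hI).
Qed.

Let k2_gt1 : 1 < k2. Proof. by lia. Qed.
Let k2_gt0 : 0 < k2. Proof. by lia. Qed.

Lemma clique_count : exists2 R, 0 < R &
  forall c x y, \sum_(b : blk | clique b) hits col b c x y = npairs k1 k2 c * R * adj x y.
Proof.
pose p0 := Ordinal k2_gt0; pose p1 := Ordinal k2_gt1.
have [b0 [cb0 _]] := exists_clique m_ge s_gt0 (A := [::]) isT.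
have n01 : p0 != p1 by [].
have a01 : adj (b0 p0) (b0 p1) by apply: (cliqueP _ cb0).
exists (cnt p0 p1 (b0 p0) (b0 p1)).
  apply/card_gt0P; exists (finfun b0); rewrite inE !ffunE !eqxx !andbT.
  by apply/cliqueP => p q npq; rewrite !ffunE; apply: (cliqueP _ cb0).
move=> c x y; rewrite exchange_big /= /npairs !big_distrl /=.
apply: eq_bigr => -[p q] /andP[/= npq _]; rewrite mul1n.
transitivity (cnt p q x y).
  rewrite /cnt -sum1_card big_mkcond [RHS]big_mkcond /=; apply: eq_bigr => b _.
  by rewrite inE; case: (clique b) => //=; case: eqP => //=; case: eqP.
case: (boolP (adj x y)) => xy; last first.
  rewrite muln0; apply/eqP; rewrite cards_eq0; apply/eqP/setP => b; rewrite !inE.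
  apply/negP => /and3P[/cliqueP cb /eqP bx /eqP by_]; move: (cb _ _ npq).
  by rewrite bx by_ (negbTE xy).
by rewrite muln1; apply/eqP; rewrite eqn_leq !cnt_le.
Qed.

Hypotheses (dv1 : k1 - 1 %| l1 * ((m - 1) * s)) (dv2 : k2 - 1 %| l2 * ((m - 1) * s)).
Hypothesis dv3 : k1 * (k1 - 1) %| l1 * (m * s * ((m - 1) * s)).

(** A homomorphism on integer vectors indexed by colours and ordered pairs is a weighting of
    coloured pairs. If it kills all cliques, [edges_vanish] shows that it kills the target, so
    [int_span_annihilator] applies. *)
Lemma signed_decomp : exists z : blk -> int, forall c x y,
  (\sum_(b : blk | clique b) z b * (hits col b c x y)%:Z = (mu c * adj x y)%:Z)%R.
Proof.
pose M := {ffun bool * V * V -> int}.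
pose cov (b : blk) : M := if clique b then [ffun t => Posz (hits col b t.1.1 t.1.2 t.2)] else 0%R.
pose t : M := [ffun t => Posz (mu t.1.1 * adj t.1.2 t.2)%N].
have [] := @int_span_annihilator M blk cov t.
  move=> G phi phi0.
  pose delta c x y : M := [ffun t => (t == (c, x, y))%:R%R].
  have h1 b : clique b -> (\sum_(p : 'I_k2 * 'I_k2 | p.1 != p.2)
      phi (delta (col p.1 p.2) (b p.1) (b p.2)) = 0)%R.
    move=> cb; pose b' : blk := finfun b; rewrite -[RHS](phi0 b') -(raddf_sum phi); congr (phi _).
    have cb' : clique b' by apply/cliqueP => p q npq; rewrite !ffunE; apply: (cliqueP _ cb).
    rewrite /cov cb'; apply/ffunP => -[[c x] y]; rewrite sum_ffunE ffunE /= /hits.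
    rewrite (big_morph Posz PoszD (erefl _)) [RHS]big_mkcondr /=.
    apply: eq_bigr => p _; rewrite !ffunE !xpair_eqE (eq_sym c) (eq_sym x) (eq_sym y).
    by case: (_ == c) => //=; case: (_ && _).
  have := @edges_vanish k1 k2 l1 l2 m s k1_gt1 k12 l1_gt0 l_eq m_ge s_gt0 G
    (fun c x y => phi (delta c x y)) h1 dv1 dv2 dv3.
  move=> h; rewrite -[RHS]h.
  transitivity (\sum_c phi ((\sum_(x : V * V | adj x.1 x.2) delta c x.1 x.2) *+ mu c))%R; last first.
    by apply: eq_bigr => c _; rewrite raddfMn (raddf_sum phi).
  rewrite -(raddf_sum phi); congr (phi _); apply/ffunP => -[[c x] y]; rewrite sum_ffunE ffunE /=.
  have inner c' : ((\sum_(u : V * V | adj u.1 u.2) delta c' u.1 u.2) (c, x, y) =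
      ((c == c') && adj x y)%:R)%R.
    rewrite sum_ffunE; case: (boolP (adj x y)) => xy; last first.
      rewrite andbF big1 // => u ua; rewrite ffunE; case: eqP => // -[_ ex ey].
      by rewrite ex ey ua in xy.
    rewrite (bigD1 (x, y)) //= ffunE !xpair_eqE !eqxx !andbT big1 ?addr0 // => -[x' y'] /= /andP[_ nn].
    by rewrite ffunE; case: eqP => // -[_ ex ey]; rewrite ex ey eqxx in nn.
  rewrite (bigD1 c) //= ffunMnE inner eqxx /= big1 ?addr0 => [|c' nc]; last first.
    by rewrite ffunMnE inner eq_sym (negbTE nc) mul0rn.
  case: (adj x y); rewrite ?muln0 ?mul0rn ?muln1 //=; exact: (esym (natz _)).
move=> z tE; exists z => c x y.
have := congr1 (fun f : M => f (c, x, y)) tE; rewrite sum_ffunE ffunE /= => ->.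
rewrite big_mkcond; apply: eq_bigr => b _.
have mzE (f : M) n u : (f *~ n)%R u = (f u *~ n)%R.
  by case: n => n; rewrite ?NegzE ?mulrNz ?ffunE -?pmulrn ffunMnE.
rewrite mzE /cov; case: (clique b); rewrite ffunE ?mul0rz //= mulrzz mulrC //.
Qed.

Lemma GDD_field : exists q0, forall F : finFieldType, q0 <= #|F| ->
  forall n, m * s < n -> GDD col mu (s * #|F| ^ n) m.
Proof.
have [R R_gt0 RE] := clique_count; have [z zE] := signed_decomp.
pose A := k1 * (k1 - 1) * R; pose Z := \sum_(b : blk) absz (z b).
have A_gt0 : 0 < A by rewrite !muln_gt0 R_gt0 andbT; clear -k1_gt1; lia.
(* The first summand forces [A * Z <= w]; the second gives [F] enough elements to embed
   [option V]. *)
exists (A * (A * Z).+1 + (m * s).+1) => F qF n ns.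
set q := #|F| in qF *; pose u := q %% A; pose w := q %/ A.
have uw : u + w * A = q by rewrite addnC -divn_eq.
have u_lt : u < A by rewrite ltn_mod.
have w_ge : A * Z <= w.
  by rewrite /w leq_divRL // mulnC; apply: leq_trans qF; apply: leq_trans (leq_addr _ _); rewrite leq_mul2l leqnSn orbT.
(* Taking the signed solution [u] times and every clique [w * l1] more times gives multiplicities
   [(u + w * A) * mu c = q * mu c]. Coefficients are nonnegative since
   [u * absz (z b) <= A * Z <= w]. *)
pose y (b : blk) : nat := absz (Posz u * z b + Posz (w * l1)%N)%R.
have yE b : Posz (y b) = (Posz u * z b + Posz (w * l1)%N)%R.
  have zb : absz (z b) <= Z by rewrite /Z (bigD1 b) //= leq_addr.
  have uz : u * absz (z b) <= w * l1.
    apply: (leq_trans (leq_mul (ltnW u_lt) zb)); apply: (leq_trans w_ge).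
    by rewrite leq_pmulr.
  rewrite /y gez0_abs //; move: uz; generalize (w * l1) => W; clear; nia.
pose I := {b : blk & 'I_(if clique b then y b else 0)}.
pose B (i : I) : 'I_k2 -> V := tag i.
have BE c x x' : \sum_i hits col (B i) c x x' = q * mu c * adj x x'.
  rewrite /B -(@sig_big_dep _ _ _ blk (fun b => 'I_(if clique b then y b else 0)) xpredT (fun _ => xpredT)
    (fun b i => hits col b c x x')) /=.
  under eq_bigr do rewrite sum_nat_const card_ord.
  apply/eqP; rewrite -eqz_nat; apply/eqP.
  rewrite (big_morph Posz PoszD (erefl _)).
  transitivity (\sum_(b : blk | clique b) (Posz u * (z b * Posz (hits col b c x x')) + Posz (w * l1)%N * Posz (hits col b c x x')))%R.
    rewrite [RHS]big_mkcond; apply: eq_bigr => b _; case: (clique b); rewrite ?mul0n // PoszM yE; ring.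
  rewrite big_split -!mulr_sumr zE /= -(big_morph Posz PoszD (erefl _)) RE -!PoszM -PoszD; congr Posz.
  rewrite -uw -[w * l1 * _]mulnA; have := nest_mu_npairs c k1_gt1 k12 l_eq => h.
  have -> : l1 * (npairs k1 k2 c * R * adj x x') = l1 * npairs k1 k2 c * R * adj x x' by ring.
  rewrite h /A; ring.
have cO : #|{: option V}| = (m * s).+1 by rewrite card_option card_prod !card_ord.
have cO1 : #|{: option V}| <= n by rewrite cO.
have cO2 : #|{: option V}| <= #|F| by rewrite cO; apply: leq_trans qF; rewrite leq_addl.
pose iota (o : option V) : 'I_n := widen_ord cO1 (enum_rank o).
pose kap (o : option V) : F := enum_val (widen_ord cO2 (enum_rank o)).
have iotaI : injective iota by move=> o o' /(congr1 val) /= /val_inj /enum_rank_inj.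
have kapI : injective kap by move=> o o' /enum_val_inj /(congr1 val) /= /val_inj /enum_rank_inj.
have := decomp_blowup (@nest_col_sym k1 k2) (@adj_irr m s) (@adj_sym m s) iotaI kapI BE.
pose U := {ffun 'I_n -> F}; move=> dec.
apply: (@GDD_of_type _ _ _ 'I_m ('I_s * U)%type); first by rewrite card_prod card_ffun !card_ord.
  by rewrite card_ord.
apply: (@decomp_bij _ _ _ _ _ _ _ (fun a : V * U => (a.1.1, (a.1.2, a.2))) _ _ _ dec).
- by rewrite !card_prod mulnA.
- by move=> [[a a'] c] [[b b'] d] /= [-> -> ->].
- by [].
Qed.
End Positive.

(** * Cyclotomic classes *)

Section PowerResidues.
Local Open Scope ring_scope.
Variables (F : finFieldType) (e f : nat).
Hypotheses (e_gt0 : (0 < e)%N) (f_gt0 : (0 < f)%N) (qE : #|F| = (e * f).+1).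

(** The [e]-th roots of unity: through [x ^+ f] they label the cosets of the group of [e]-th powers,
    which are the cyclotomic classes. *)
Definition residue_classes : {set F} := [set x | x ^+ e == 1].

Lemma card_roots_le n (c : F) : (0 < n)%N -> (#|[set x : F | x ^+ n == c]| <= n)%N.
Proof.
move=> n_gt0; have := @max_poly_roots F ('X^n - c%:P) (enum [set x : F | x ^+ n == c]).
rewrite -size_poly_eq0 size_XnsubC // => /(_ isT) h; rewrite cardE -ltnS; apply: h.
  apply/allP => x; rewrite mem_enum inE => /eqP xn.
  by rewrite rootE !hornerE xn subrr.
exact: enum_uniq.
Qed.

Lemma expf_in_residue_classes x : x != 0 -> x ^+ f \in residue_classes.
Proof.
move=> x0; rewrite inE -exprM; apply/eqP; apply: (mulfI x0); rewrite -exprS mulr1.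
by rewrite mulnC -qE expf_card.
Qed.

Lemma residue_classes_neq0 c : c \in residue_classes -> c != 0.
Proof.
rewrite inE; apply: contraTneq => ->; rewrite expr0n; case: e e_gt0 => //= n _.
by rewrite eq_sym oner_eq0.
Qed.

(** The map [x ^+ f] sends the [e * f] nonzero elements into this set with fibres of size at most
    [f], so the root bound [e] is attained. *)
Lemma card_residue_classes : #|residue_classes| = e.
Proof.
apply/eqP; rewrite eqn_leq card_roots_le //= -(leq_pmul2r f_gt0).
have -> : (e * f = #|[set~ (0%R : F)]|)%N by rewrite cardsC1 qE.
rewrite -sum1_card.
rewrite (partition_big (fun x : F => x ^+ f) (mem residue_classes)) /=; last first.
  by move=> x; rewrite !inE => x0; have := expf_in_residue_classes x0; rewrite inE.
rewrite -sum_nat_const; apply: leq_sum => c _.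
rewrite sum1_card; apply: leq_trans (card_roots_le c f_gt0).
by apply: subset_leq_card; apply/subsetP => x; rewrite !inE => /andP[].
Qed.

Section SecondMoment.
Variable T : {set F}.
Let N c a : nat := #|[set t in T | (t - a) ^+ f == c]|.

Let sumN : (\sum_(c in residue_classes) \sum_a N c a = #|T| * (e * f))%N.
Proof.
rewrite exchange_big /=.
under eq_bigr do under eq_bigr do rewrite /N -sum1dep_card big_mkcondr /=.
under eq_bigr do rewrite exchange_big /=.
rewrite exchange_big /= (eq_bigr (fun=> e * f)%N) ?sum_nat_const // => t _.
rewrite (bigD1 t) //= big1 ?add0n => [|c cC]; last first.
  rewrite subrr expr0n eqn0Ngt f_gt0 /=; case: eqP => // c0.
  by have := residue_classes_neq0 cC; rewrite -c0 eqxx.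
rewrite (eq_bigr (fun=> 1%N)) ?sum1_card ?cardC1 ?qE // => a na.
have h : (t - a) ^+ f \in residue_classes by apply: expf_in_residue_classes; rewrite subr_eq0 eq_sym.
rewrite (bigD1 ((t - a) ^+ f)) //= eqxx big1 ?addn0 // => c /andP[_ nc].
by rewrite eq_sym (negbTE nc).
Qed.

(* For t <> t' the map a |-> (t - a) / (t' - a) is injective and omits 1. *)
Let pair_count t t' : t != t' ->
  (\sum_(c in residue_classes) \sum_a ((t - a) ^+ f == c) * ((t' - a) ^+ f == c) <= f - 1)%N.
Proof.
move=> ntt; rewrite exchange_big /=.
pose A := [set a | (t - a) ^+ f == (t' - a) ^+ f].
pose H := [set h : F | h ^+ f == 1].
have tA a : a \in A -> t' - a != 0 /\ t - a != 0.
  rewrite inE => /eqP h; suff : ~~ ((t' - a == 0) || (t - a == 0)) by rewrite negb_or => /andP[].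
  apply/negP => /orP[] /eqP z; move: h; rewrite z expr0n eqn0Ngt f_gt0 /=.
    by move/eqP; rewrite expf_eq0 f_gt0 subr_eq0 => /eqP ta; move/eqP: z; rewrite -ta subr_eq0 eq_sym (negbTE ntt).
  move/esym/eqP; rewrite expf_eq0 f_gt0 subr_eq0 => /eqP ta; move/eqP: z; rewrite -ta subr_eq0.
  by rewrite (negbTE ntt).
apply: (@leq_trans #|A|).
  rewrite -sum1_card [leqRHS]big_mkcond; apply: leq_sum => a _; rewrite [a \in A]inE.
  case: eqP => [h|nh]; last first.
    rewrite big1 // => c _; case: eqP => // h1; case: eqP => // h2.
    by case: nh; rewrite h1 h2.
  have [cc|cc] := boolP ((t - a) ^+ f \in residue_classes).
    rewrite (bigD1 ((t - a) ^+ f)) //= eqxx -h eqxx big1 ?addn0 // => c /andP[_ nc].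
    by rewrite eq_sym (negbTE nc).
  rewrite big1 // => c cC; case: eqP => // h1.
  by rewrite h1 cC in cc.
apply: (@leq_trans #|H :\ 1|); last first.
  have := card_roots_le 1 f_gt0; rewrite -/H (cardsD1 1 H) inE expr1n eqxx /= => h.
  by rewrite -[leqLHS](addKn 1%N) leq_sub2r.
rewrite -(card_in_imset (f := fun a => (t - a) / (t' - a)) (D := A)).
  apply: subset_leq_card; apply/subsetP => _ /imsetP[a aA ->].
  have [h0 h1] := tA _ aA; move: aA; rewrite !inE => /eqP h.
  rewrite expr_div_n h divff ?expf_neq0 // eqxx andbT.
  apply: contra ntt => /eqP /(congr1 (fun z => z * (t' - a))); rewrite mulfVK // mul1r.
  by move/eqP; rewrite (inj_eq (addIr _)).
move=> a b aA bA; have [ha0 ha1] := tA _ aA; have [hb0 hb1] := tA _ bA.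
move=> /(congr1 (fun z => z * (t' - a) * (t' - b))); rewrite mulfVK // mulrAC mulfVK //.
move=> h; have : (t - t') * (a - b) = 0.
  have -> : (t - t') * (a - b) = (t - a) * (t' - b) - (t - b) * (t' - a) by ring.
  by rewrite h subrr.
by move/eqP; rewrite mulf_eq0 !subr_eq0 (negbTE ntt) => /eqP.
Qed.

(** The squares count ordered pairs from [T]: equal ones as in [sumN], distinct ones by
    [pair_count]. *)
Let sumN2 : (\sum_(c in residue_classes) \sum_a N c a ^ 2 <= #|T| * (e * f) + #|T| * #|T| * (f - 1))%N.
Proof.
have sq c a : (N c a ^ 2 = \sum_(t in T) \sum_(t' in T) ((t - a) ^+ f == c) * ((t' - a) ^+ f == c))%N.
  have NE : (N c a = \sum_(t in T) ((t - a) ^+ f == c))%N.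
    by rewrite /N -sum1dep_card big_mkcondr; apply: eq_bigr => t _; case: eqP.
  by rewrite -mulnn {1}NE big_distrl /=; apply: eq_bigr => t _; rewrite NE big_distrr.
under eq_bigr do under eq_bigr do rewrite sq.
under eq_bigr do rewrite exchange_big /=.
rewrite exchange_big /=.
under eq_bigr do under eq_bigr do rewrite exchange_big /=.
under eq_bigr do rewrite exchange_big /=.
apply: (@leq_trans (\sum_(t in T) (e * f + #|T| * (f - 1)))%N); last first.
  by rewrite sum_nat_const mulnDr [(#|T| * (_ * (f - 1)))%N]mulnA.
apply: leq_sum => t tT; rewrite (bigD1 t) //=; apply: leq_add.
  under eq_bigr do under eq_bigr do rewrite mulnb andbb.
  rewrite exchange_big /= (bigD1 t) //= big1 ?add0n => [|c cC]; last first.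
    rewrite subrr expr0n eqn0Ngt f_gt0 /=; case: eqP => // c0.
    by have := residue_classes_neq0 cC; rewrite -c0 eqxx.
  rewrite [leqRHS](_ : _ = \sum_(a | a != t) 1)%N; last by rewrite sum1_card cardC1 qE.
  apply: leq_sum => a na.
  have h : (t - a) ^+ f \in residue_classes by apply: expf_in_residue_classes; rewrite subr_eq0 eq_sym.
  rewrite (bigD1 ((t - a) ^+ f)) //= eqxx big1 ?addn0 // => c /andP[_ nc].
  by rewrite eq_sym (negbTE nc).
apply: (@leq_trans (\sum_(t' in T | t' != t) (f - 1))%N).
  by apply: leq_sum => t' /andP[_ n]; apply: pair_count; rewrite eq_sym.
rewrite sum_nat_const leq_mul2r; apply/orP; right; apply: subset_leq_card.
by apply/subsetP => t'; rewrite unfold_in => /andP[].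
Qed.

(** Chebyshev's inequality: over all classes and all [a], the squared deviations of [e * N c a] from
    [#|T|] sum to at most [2 * e ^ 2 * #|T| * #|F|], while each bad [a] contributes at least
    [#|T| ^ 2 / 4]. *)
Lemma few_bad c : c \in residue_classes ->
  (#|[set a | (2 * e * #|[set t in T | (t - a) ^+ f == c]| < #|T|)%N]| * #|T| <= 8 * e ^ 2 * #|F|)%N.
Proof.
move=> cC; set Bad := [set a | _]; rewrite -/(N c _) in Bad *.
have [->|T_gt0] := posnP #|T|; first by rewrite muln0.
pose n := Posz #|T|; pose dev c a : int := (Posz e * Posz (N c a) - n) ^+ 2.
have dev_ge0 c' a : (0 <= dev c' a)%R by apply: sqr_ge0.
have h1 : (Posz #|Bad| * n ^+ 2 <= 4 * \sum_(c in residue_classes) \sum_a dev c a)%R.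
  rewrite (bigD1 c) //= mulrDr; apply: ler_wpDr.
    by apply: mulr_ge0 => //; apply: sumr_ge0 => ? _; apply: sumr_ge0.
  rewrite (bigID (mem Bad)) /= mulrDr; apply: ler_wpDr.
    by apply: mulr_ge0 => //; apply: sumr_ge0.
  rewrite mulr_sumr -[Posz #|Bad|]natz mulr_natl -sumr_const; apply: ler_sum => a.
  rewrite inE -/(N c a) /dev /n; generalize (N c a) => x; generalize #|T| => y; clear.
  rewrite -mulnA -PoszM; generalize (e * x)%N => z h; rewrite -subr_ge0.
  have -> : 4 * (Posz z - Posz y) ^+ 2 - Posz y ^+ 2 =
      (Posz y - 2 * Posz z) * (3 * Posz y - 2 * Posz z) by ring.
  by apply: mulr_ge0; lia.
have h2 : (\sum_(c in residue_classes) \sum_a dev c a <= 2 * Posz e ^+ 2 * n * Posz #|F|)%R.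
  have devE c' a : dev c' a = Posz e ^+ 2 * Posz (N c' a ^ 2)%N - 2 * Posz e * n * Posz (N c' a) + n ^+ 2.
    by rewrite /dev -mulnn PoszM; ring.
  under eq_bigr do under eq_bigr do rewrite devE.
  under eq_bigr do rewrite big_split sumrB /= -!mulr_sumr sumr_const.
  rewrite big_split sumrB /= -!mulr_sumr sumr_const card_residue_classes.
  under [X in _ * X - _]eq_bigr do rewrite -(big_morph Posz PoszD (erefl _)).
  under [X in _ - _ * X]eq_bigr do rewrite -(big_morph Posz PoszD (erefl _)).
  rewrite -!(big_morph Posz PoszD (erefl _)) sumN; have := sumN2.
  rewrite qE -mulrnA -(mulr_natr n) natz /n.
  move: e_gt0 f_gt0; move: (\sum_(c in residue_classes) _)%N #|T|; clear => S x e0 f0 hS.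
  have {}hS : 0 <= Posz x * (Posz e * Posz f) + Posz x * Posz x * (Posz f - 1) - Posz S.
    by rewrite subr_ge0 (subzn f0) -!PoszM -PoszD lez_nat.
  rewrite -subr_ge0 -(addn1 (e * f)) ?(PoszM, PoszD); set X := (X in 0 <= X).
  (* Once the bound on [S] is split off, the terms in [x ^ 2 * f] cancel and only nonnegative terms
     remain. *)
  have -> : X = Posz e ^+ 2 * (Posz x * (Posz e * Posz f) + Posz x * Posz x * (Posz f - 1) - Posz S)
     + (Posz e ^+ 3 * Posz x * Posz f + 2 * Posz e ^+ 2 * Posz x + Posz e * Posz x ^+ 2 * (Posz e - 1)).
    by rewrite /X; ring.
  have e1 : 0 <= Posz e - 1 by lia.
  apply: addr_ge0; first by apply: mulr_ge0 => //; apply: exprn_ge0.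
  apply: addr_ge0; last by apply: mulr_ge0 => //; apply: mulr_ge0 => //; apply: exprn_ge0.
  by apply: addr_ge0; do ?[apply: mulr_ge0 | apply: exprn_ge0].
have h3 : (Posz #|Bad| * n ^+ 2 <= 4 * (2 * Posz e ^+ 2 * n * Posz #|F|))%R.
  by apply: le_trans h1 _; apply: ler_wpM2l.
rewrite -(leq_pmul2r T_gt0) -lez_nat.
have -> : Posz (#|Bad| * #|T| * #|T|) = Posz #|Bad| * n ^+ 2 by rewrite !PoszM /n; ring.
have -> : Posz (8 * e ^ 2 * #|F| * #|T|) = 4 * (2 * Posz e ^+ 2 * n * Posz #|F|).
  by rewrite -mulnn !PoszM /n; ring.
exact: h3.
Qed.
End SecondMoment.
End PowerResidues.

(* Choose a_0, a_1, ... greedily: all but boundedly many choices of a_0 keep a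
   positive proportion of the candidates for every later term. *)
Lemma prescribed_differences (e k K : nat) : 0 < e ->
  exists q0, forall (F : finFieldType) (f : nat), 0 < f -> #|F| = (e * f).+1 -> q0 <= #|F| ->
  forall (T : nat -> {set F}) (c : nat -> nat -> F),
    (forall i, i < k -> #|F| <= K * #|T i|) ->
    (forall i j, c i j \in residue_classes F e) ->
  exists a : nat -> F, (forall i, i < k -> a i \in T i) /\
    (forall i j, i < j -> j < k -> ((a j - a i) ^+ f)%R = c i j).
Proof.
move=> e_gt0; elim: k K => [|k IHk] K.
  by exists 0 => F f _ _ _ T c _ _; exists (fun=> 0%R).
(* A good [a0] keeps at least a share [1 / (2 * e)] of each later candidate set. *)
have [q1 IH] := IHk (2 * e * K).
(* The second summand exceeds [K] times the total size of the bad sets, so they cannot cover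
   [T 0]. *)
exists (q1 + (K * (k * (8 * e ^ 2 * K))).+1) => F f f_gt0 qE qF T c TK cC.
pose bad i := [set a : F | 2 * e * #|[set t in T i | ((t - a) ^+ f)%R == c 0 i]| < #|T i|].
have T_gt0 i : i < k.+1 -> 0 < #|T i|.
  by move=> ik; have := TK i ik; rewrite qE; case: #|T i| => //; rewrite muln0.
have bad_le i : i < k.+1 -> #|bad i| <= 8 * e ^ 2 * K.
  move=> ik; rewrite -(leq_pmul2r (T_gt0 i ik)).
  apply: (leq_trans (few_bad e_gt0 f_gt0 qE (T i) (cC 0 i))).
  by rewrite -[leqRHS]mulnA leq_mul2l TK // orbT.
have [a0 a0T a0b] : exists2 a0, a0 \in T 0 & forall i, i < k -> a0 \notin bad i.+1.
  have /subsetPn [a aT ab] : ~~ (T 0 \subset \bigcup_(i < k) bad i.+1).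
    apply/negP => /subset_leq_card h.
    have h2 : #|\bigcup_(i < k) bad i.+1| <= k * (8 * e ^ 2 * K).
      apply: (@leq_trans (\sum_(i < k) #|bad i.+1|)); last first.
        rewrite -[k in leqRHS]card_ord -sum_nat_const; apply: leq_sum => i _.
        by apply: bad_le; rewrite ltnS.
      apply: (big_ind2 (fun (A : {set F}) n => #|A| <= n)) => [|A1 n1 A2 n2 h1 h2|//].
        by rewrite cards0.
      by apply: leq_trans (leq_add h1 h2); rewrite cardsU leq_subr.
    have := TK 0 isT; have := leq_mul (leqnn K) (leq_trans h h2); lia.
  exists a => // i ik; apply: contra ab => ab.
  by apply/bigcupP; exists (Ordinal ik).
pose T' i := [set t in T i.+1 | ((t - a0) ^+ f)%R == c 0 i.+1].
have [|i ik|i j|a [aT ac]] := IH F f f_gt0 qE _ T' (fun i j => c i.+1 j.+1).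
- by apply: leq_trans qF; rewrite leq_addr.
- have := a0b i ik; rewrite inE -leqNgt => h; apply: (leq_trans (TK i.+1 ik)).
  by rewrite [2 * e * K]mulnC -[leqRHS]mulnA leq_mul2l h orbT.
- exact: cC.
exists (fun i => if i is i'.+1 then a i' else a0); split=> [[|i] ik //|[|i] [|j] ij jk //].
- by have := aT i ik; rewrite inE => /andP[].
- by have := aT j jk; rewrite inE => /andP[_ /eqP].
- exact: ac.
Qed.

Lemma finField_two_neq0 (F : finFieldType) : odd #|F| -> (1 + 1 != 0 :> F)%R.
Proof.
move=> oF; apply/eqP => h.
have n0 : (1 *+ #|F| = 0 :> F)%R.
  by have := @cyclic.expg_cardG _ [set: F]%G (1%R : F) (in_setT _); rewrite cardsT.
have h2 n : (1 *+ n.*2 = 0 :> F)%R by rewrite -mul2n mulrnA mulr2n h mul0rn.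
move: n0; rewrite -(odd_double_half #|F|) oF mulrnDr h2 addr0 => /eqP.
by rewrite oner_eq0.
Qed.

(** * Nestings on finite fields *)

Section FieldDesign.
Variables (k1 k2 l1 l2 : nat).
Hypotheses (k1_gt1 : 1 < k1) (k12 : k1 < k2).
Hypothesis l_eq : l1 * (k2 * (k2 - 1)) = l2 * (k1 * (k1 - 1)).
Local Notation col := (@nest_col k1 k2).
Local Notation mu := (nest_mu l1 l2).

(** The [2 * l1] base blocks have, for each colour [c], exactly [mu c] pairs of positions with
    difference in each cyclotomic class. They are developed under all translations and half of the
    [f]-th roots of unity: as [f] is even, [-1] is such a root, and a half suffices for unordered
    pairs. *)
Lemma design_field : exists q0, forall F : finFieldType, q0 <= #|F| ->
  2 * (k1 * (k1 - 1)) %| #|F| - 1 -> design col mu #|F|.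
Proof.
pose e := k1 * (k1 - 1).
have e_gt0 : 0 < e by rewrite muln_gt0; clear -k1_gt1; lia.
have [q0 hq0] := prescribed_differences k2 1 e_gt0.
exists q0 => F qF /dvdnP [g gE].
have F_gt1 := finRing_gt1 F.
have qE2 : #|F| = (e * (2 * g)).+1.
  by rewrite -[LHS](subnK (ltnW F_gt1)) gE addn1; congr _.+1; rewrite -/e; clear; ring.
pose f := 2 * g; have f_gt0 : 0 < f.
  by move: F_gt1; rewrite qE2 /f; case: (2 * g) => //; rewrite muln0.
have oF : odd #|F| by rewrite qE2 /= mulnCA oddM.
pose C := {x : F | x \in residue_classes F e}.
have cC : #|{: C}| = e.
  by rewrite card_sig -[RHS](card_residue_classes e_gt0 f_gt0 qE2); apply: eq_card => x; rewrite !inE.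
have one_C : 1%R \in residue_classes F e by rewrite inE expr1n.
pose A := ('I_(2 * l1) * ('I_k2 * 'I_k2))%type.
pose P c : {set A} := [set x : A | (x.2.1 < x.2.2) && (col x.2.1 x.2.2 == c)].
have cP c : #|P c| = #|{: C}| * mu c.
  pose hh := \sum_(p : 'I_k2 * 'I_k2 | (p.1 < p.2) && (col p.1 p.2 == c)) 1.
  have hhE : npairs k1 k2 c = 2 * hh.
    rewrite /npairs (big_half addn (P := fun p p' : 'I_k2 => nest_col k1 p p' == c) (fun _ _ => 1) val_inj).
      by rewrite /hh big_distrr.
    by move=> p q; rewrite nest_col_sym.
  rewrite cC [RHS]mulnC -(nest_mu_npairs c k1_gt1 k12 l_eq) hhE.
  transitivity (\sum_(t < 2 * l1) hh).
    rewrite /hh pair_big_dep -sum1_card; apply: eq_bigl => x; by rewrite inE.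
  by rewrite sum_nat_const card_ord -mulnA mulnCA.
(* Classes are prescribed for the pairs of positions so that each is used equally often within a
   colour. *)
have /choice [g0 hg] : forall c, exists g : A -> C, forall v, #|[set a in P c | g a == v]| = mu c.
  by move=> c; apply: uniform_coloring (cP c); exists 1%R.
pose cls (t : 'I_(2 * l1)) (i j : nat) : F :=
  if insub i is Some i then if insub j is Some j then val (g0 (col i j) (t, (i, j))) else 1%R else 1%R.
have clsC t i j : cls t i j \in residue_classes F e.
  by rewrite /cls; case: insubP => [i' _ _|_] //; case: insubP => [j' _ _|_] //; apply: valP.
have clsE t (i j : 'I_k2) : cls t i j = val (g0 (col i j) (t, (i, j))) by rewrite /cls !valK.
have /choice [a ha] : forall t, exists a : 'I_k2 -> F, forall i j : 'I_k2, i < j ->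
    ((a j - a i) ^+ f)%R = val (g0 (col i j) (t, (i, j))).
  move=> t; have [i _|i j|a [_ aE]] := hq0 F f f_gt0 qE2 qF (fun=> setT) (cls t).
  - by rewrite cardsT mul1n.
  - exact: clsC.
  - by exists (fun i => a i) => i j ij; rewrite aE // clsE.
have neg_f (x : F) : ((- x) ^+ f = x ^+ f)%R by rewrite /f !exprM sqrrN.
have two0 := finField_two_neq0 oF.
(* Selects one of [x] and [- x], which differ for nonzero [x] because [F] has odd order. *)
pose hf (x : F) := enum_rank x < enum_rank (- x)%R.
have hfE x : x != 0%R -> hf x + hf (- x)%R = 1.
  move=> x0; rewrite /hf opprK; case: ltngtP => // /val_inj/enum_rank_inj xx.
  have : ((1 + 1) * x == 0)%R by rewrite mulrDl mul1r {1}xx addNr.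
  by rewrite mulf_eq0 (negbTE two0) (negbTE x0).
pose H0 := {h : F | ((h ^+ f)%R == 1%R) && hf h}.
pose B (i : 'I_(2 * l1) * (H0 * F)) (p : 'I_k2) : F := (val i.2.1 * a i.1 p + i.2.2)%R.
have aN t i j : i != j -> a t i != a t j.
  wlog ij : i j / i < j.
    move=> h nij; case: (ltngtP i j) => [l|l|/val_inj e0]; first exact: h.
      by rewrite eq_sym; apply: h => //; rewrite eq_sym.
    by rewrite e0 eqxx in nij.
  move=> _; have := residue_classes_neq0 e_gt0 (valP (g0 (col i j) (t, (i, j)))).
  rewrite -ha // expf_eq0 f_gt0 /= subr_eq0 eq_sym.
  by [].
have h0N (h : H0) : val h != 0%R.
  apply: contraTneq (valP h) => ->; rewrite expr0n eqn0Ngt f_gt0 /=.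
  by rewrite eq_sym oner_eq0.
apply: (@design_of_type _ _ _ F) => //.
exists ('I_(2 * l1) * (H0 * F))%type, B => cc x y.
have [<-|nxy] := eqVneq x y.
  rewrite muln0; apply: big1 => i _; apply: big1 => p /andP[np _].
  case: eqP => // h1; case: eqP => // h2; move: (aN i.1 _ _ np).
  have := etrans h1 (esym h2); rewrite /B => /addIr /(mulfI (h0N _)) ->.
  by rewrite eqxx.
rewrite muln1.
pose v := ((x - y) ^+ f)%R.
have vC : v \in residue_classes F e.
  by apply: (expf_in_residue_classes qE2); rewrite subr_eq0.
rewrite -(hg cc (Sub v vC)) -sum1_card.
rewrite -(pair_bigA _ (fun t hc => hits col (B (t, hc)) cc x y)) /=.
pose G t (p p' : 'I_k2) : nat := let rho := ((x - y) / (a t p - a t p'))%R in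
  ((rho ^+ f)%R == 1%R) && hf rho.
have step t p : p.1 != p.2 ->
    \sum_(hc : H0 * F) ((B (t, hc) p.1 == x) && (B (t, hc) p.2 == y)) = G t p.1 p.2.
  move=> np; have d0 : (a t p.1 - a t p.2 != 0)%R by rewrite subr_eq0 aN.
  pose rho := ((x - y) / (a t p.1 - a t p.2))%R.
  have key hc : ((B (t, hc) p.1 == x) && (B (t, hc) p.2 == y)) =
      (val hc.1 == rho) && (hc.2 == x - rho * a t p.1)%R.
    have BE q : B (t, hc) q = (val hc.1 * a t q + hc.2)%R by [].
    rewrite !BE; move: (val hc.1) hc.2 => h c; apply/andP/andP => -[/eqP h1 /eqP h2].
      have hr : h = rho by apply: (mulIf d0); rewrite /rho mulfVK // -h1 -h2; ring.
      by split; apply/eqP => //; rewrite -hr -h1; ring.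
    rewrite h1 h2; split; apply/eqP; first by ring.
    have -> : (rho * a t p.2 + (x - rho * a t p.1) = x - rho * (a t p.1 - a t p.2))%R by ring.
    by rewrite /rho mulfVK //; ring.
  under eq_bigr do rewrite key.
  rewrite /G -/rho; case: (boolP (_ && _)) => hr.
    rewrite (bigD1 (Sub rho hr : H0, x - rho * a t p.1)%R) //= !eqxx big1 // => -[h c] /=.
    by rewrite xpair_eqE -val_eqE /= => /negbTE ->.
  apply: big1 => -[h c] _ /=; case: eqP => // eh.
  by have := valP h; rewrite /= eh (negbTE hr).
transitivity (\sum_(t < 2 * l1) \sum_(p : 'I_k2 * 'I_k2 | (p.1 < p.2) && (col p.1 p.2 == cc))
   (g0 cc (t, p) == Sub v vC)); last first.
  rewrite pair_big_dep /= big_mkcond [RHS]big_mkcond /=; apply: eq_bigr => -[t p] _ /=.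
  by rewrite !inE /=; case: (_ && _); case: (_ == _).
apply: eq_bigr => t _; rewrite exchange_big /=.
rewrite (eq_bigr (fun p => G t p.1 p.2)) => [|p /andP[np _]]; last exact: step.
rewrite (big_half addn (P := fun p p' : 'I_k2 => nest_col k1 p p' == cc) (G t) val_inj); last first.
  by move=> p q; rewrite nest_col_sym.
apply: eq_bigr => -[p q] /= /andP[pq /eqP cpq].
have npq : p != q by rewrite -val_eqE /= neq_ltn pq.
have d0 : (a t p - a t q != 0)%R by rewrite subr_eq0 aN.
rewrite /G /=; set rho := (_ / _)%R.
have -> : ((x - y) / (a t q - a t p) = - rho)%R by rewrite -[(a t q - _)%R]opprB invrN mulrN.
have rho0 : rho != 0%R by rewrite mulf_neq0 ?invr_eq0 // subr_eq0.
rewrite neg_f -val_eqE /= -cpq -ha // -/v.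
have -> : ((rho ^+ f)%R == 1%R) = (((a t q - a t p) ^+ f)%R == v).
  rewrite -neg_f opprB /rho expr_div_n -/v -(inj_eq (mulIf (expf_neq0 f d0))) mulfVK ?expf_neq0 //.
  by rewrite mul1r eq_sym.
by case: (_ == v) => //=; apply: hfE.
Qed.
End FieldDesign.

(** * Transversal designs *)

(** [W] indexes the blocks and [phi i w] is the point of block [w] in group [i]: an orthogonal array
    of strength two and index one. *)
Definition is_TD (k : nat) (Z W : finType) (phi : 'I_k -> W -> Z) : Prop :=
  forall i j, i != j -> forall x y, exists2 w, phi i w = x /\ phi j w = y &
    forall w', phi i w' = x -> phi j w' = y -> w' = w.

Definition TD k n := exists (W : finType) (phi : 'I_k -> W -> 'I_n), is_TD phi.

Lemma TD_type k (Z W : finType) (phi : 'I_k -> W -> Z) : is_TD phi -> TD k #|Z|.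
Proof.
move=> h; exists W, (fun i w => enum_rank (phi i w)) => i j nij x y.
have [w [h1 h2] hw] := h i j nij (enum_val x) (enum_val y).
exists w; first by rewrite h1 h2 !enum_valK.
by move=> w' h1' h2'; apply: hw; rewrite -(h1', h2') -?h1' -?h2' enum_rankK.
Qed.

Lemma TD_prod k a b : TD k a -> TD k b -> TD k (a * b).
Proof.
move=> [W1 [phi1 h1]] [W2 [phi2 h2]].
have := @TD_type k ('I_a * 'I_b)%type (W1 * W2)%type (fun i w => (phi1 i w.1, phi2 i w.2)).
rewrite card_prod !card_ord; apply => i j nij [x1 x2] [y1 y2].
have [w1 [e1 e2] u1] := h1 i j nij x1 y1; have [w2 [e3 e4] u2] := h2 i j nij x2 y2.
exists (w1, w2); first by rewrite /= e1 e2 e3 e4.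
by move=> [v1 v2] [? ?] [? ?]; rewrite (u1 v1) // (u2 v2).
Qed.

Lemma TD1 k : TD k 1.
Proof.
exists 'I_1, (fun _ _ => ord0) => i j _ x y; exists ord0; first by rewrite !ord1.
by move=> w _ _; rewrite ord1.
Qed.

(** The blocks are the nonvertical affine lines over [F], restricted to [k] distinct abscissas
    [th i]. *)
Lemma TD_field k (F : finFieldType) : k <= #|F| -> TD k #|F|.
Proof.
move=> kF; pose th (i : 'I_k) : F := enum_val (widen_ord kF i).
have thI : injective th by move=> i j /enum_val_inj /(congr1 val) /= /val_inj.
apply: (@TD_type k F (F * F)%type (fun i w => w.1 + th i * w.2)%R) => i j nij x y.
have d0 : (th i - th j != 0)%R by rewrite subr_eq0 (inj_eq thI).
exists (x - th i * ((x - y) / (th i - th j)), (x - y) / (th i - th j))%R => /=.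
  by split; field.
by move=> [s t] /= <- <-; congr pair; field.
Qed.

(** Split off one full prime power at a time: it is the order of a field, and [TD_prod] multiplies
    the factors. *)
Lemma TD_MacNeish k n : 0 < n ->
  (forall p, prime p -> p %| n -> k <= p ^ logn p n) -> TD k n.
Proof.
elim/ltn_ind: n => n IH n_gt0 hp.
have [n1|n_gt1] := leqP n 1; first by rewrite (_ : n = 1); [exact: TD1 | lia].
have [p pr pn] : exists2 p, prime p & p %| n by exists (pdiv n); rewrite ?pdiv_prime ?pdiv_dvd.
have [m cpm nE] := pfactor_coprime pr n_gt0.
have a_gt0 : 0 < logn p n by rewrite logn_gt0 mem_primes pr n_gt0.
have pa_gt1 : 1 < p ^ logn p n by rewrite -(expn0 p) ltn_exp2l // prime_gt1.
have m_gt0 : 0 < m by move: n_gt0; rewrite nE; case: m {cpm nE}.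
rewrite nE; apply: TD_prod; last first.
  have [F _ cF] := pPrimePowerField pr a_gt0.
  by rewrite -cF; apply: TD_field; rewrite cF hp.
apply: IH => // [|r rpr rm]; first by rewrite nE -[ltnLHS]muln1 ltn_pmul2l.
have rn : r %| n by rewrite nE dvdn_mulr.
have -> : logn r m = logn r n; last exact: hp.
have npr : p != r by apply: contraTneq cpm => ->; rewrite prime_coprime // negbK.
rewrite [n in RHS]nE (lognM _ m_gt0 (ltnW pa_gt1)) lognX.
have -> : logn r p = 0; last by rewrite muln0 addn0.
by rewrite logn_prime // eq_sym (negbTE npr).
Qed.

Lemma TD_coprime k n : 0 < n -> coprime n k`! -> TD k n.
Proof.
move=> n_gt0 cop; apply: TD_MacNeish => // p pr pn.
have kp : k < p.
  rewrite ltnNge; apply/negP => pk.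
  have pk' : p %| k`! by apply: dvdn_fact; rewrite prime_gt0.
  have : p %| gcdn n k`! by rewrite dvdn_gcd pn.
  by rewrite (eqP cop) dvdn1 => /eqP p1; rewrite p1 in pr.
apply: (leq_trans (ltnW kp)); rewrite -{1}(expn1 p) leq_exp2l ?prime_gt1 //.
by rewrite logn_gt0 mem_primes pr n_gt0.
Qed.

(** A prime divisor above [k] is large enough by itself; a prime up to [k] divides [n] with exponent
    at least [k], and [k < p ^ k]. *)
Lemma TD_dvd_fact k n : 0 < n -> k`! ^ k %| n -> TD k n.
Proof.
move=> n_gt0 dv; apply: TD_MacNeish => // p pr pn.
have [kp|pk] := ltnP k p.
  apply: (leq_trans (ltnW kp)); rewrite -{1}(expn1 p) leq_exp2l ?prime_gt1 //.
  by rewrite logn_gt0 mem_primes pr n_gt0.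
have pk' : p %| k`! by apply: dvdn_fact; rewrite prime_gt0.
have : p ^ k %| n by apply: dvdn_trans dv; apply: dvdn_exp2r.
rewrite pfactor_dvdn // => h; apply: (leq_trans (ltnW (ltn_expl k (prime_gt1 pr)))).
by rewrite leq_exp2l ?prime_gt1.
Qed.

Section Transversal.
Variables (k x : nat) (W P : finType) (phi : 'I_k -> W -> 'I_x).
Variables (grp : P -> 'I_k) (pos : P -> 'I_x).
Hypothesis td : is_TD phi.
Hypothesis pos_inj : forall p p', grp p = grp p' -> pos p = pos p' -> p = p'.

(** [P] sits in the [k] by [x] grid through [grp] and [pos] without having to fill it, so truncated
    designs are covered as well. *)
Definition td_block (w : W) : {set P} := [set p | phi (grp p) w == pos p].

Lemma td_block_grp w p p' : p != p' -> p \in td_block w -> p' \in td_block w -> grp p != grp p'.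
Proof.
rewrite !inE => npp /eqP h /eqP h'; apply: contra npp => /eqP e; apply/eqP/pos_inj => //.
by rewrite -h -h' e.
Qed.

Lemma td_block_uniq w w' p p' : p != p' -> p \in td_block w -> p' \in td_block w ->
  p \in td_block w' -> p' \in td_block w' -> w = w'.
Proof.
move=> npp pw p'w; have := td_block_grp npp pw p'w => /td h.
have [v _ hv] := h (pos p) (pos p').
move: pw p'w; rewrite !inE => /eqP h1 /eqP h2 /eqP h3 /eqP h4.
by rewrite (hv w) // (hv w').
Qed.

Lemma td_block_ex p p' : grp p != grp p' -> exists w, (p \in td_block w) && (p' \in td_block w).
Proof. by move=> /td h; have [w [h1 h2] _] := h (pos p) (pos p'); exists w; rewrite !inE h1 h2 !eqxx. Qed.

Lemma td_block_exE p p' : [exists w, (p \in td_block w) && (p' \in td_block w)] && (p != p') = (grp p != grp p').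
Proof.
apply/andP/idP => [[/existsP[w /andP[h1 h2]] npp]|ng]; first exact: td_block_grp h1 h2.
by split; [apply/existsP; exact: td_block_ex | apply: contra ng => /eqP ->].
Qed.
End Transversal.

(** * Weighting points and filling groups *)

Section Closure.
Variables (k : nat) (col : 'I_k -> 'I_k -> bool) (mu : bool -> nat).
Local Notation decomp := (decomp col mu).
Local Notation GDD := (GDD col mu).
Local Notation design := (design col mu).

(** Wilson's fundamental construction: every point gets weight [g], and a group divisible design is
    placed over each block. *)
Lemma decomp_blocks (P J : finType) (g : nat) (A : J -> {set P}) :
  (forall j, GDD g #|A j|) ->
  (forall j j' p p', p != p' -> p \in A j -> p' \in A j -> p \in A j' -> p' \in A j' -> j = j') ->
  decomp (fun x y : P * 'I_g => [exists j, (x.1 \in A j) && (y.1 \in A j)] && (x.1 != y.1)).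
Proof.
move=> hA hu.
apply: (@decomp_pieces _ _ _ _ J (fun j => ('I_#|A j| * 'I_g)%type) _
  (fun j x y => x.1 != y.1) (fun j x => (enum_val x.1, x.2))) => //.
- by move=> j [a u] [b v] [/enum_val_inj -> ->].
- move=> j a b nab; rewrite (inj_eq enum_val_inj) nab andbT.
  by apply/existsP; exists j; rewrite !enum_valP.
- move=> [p u] [p' v] /= /andP[/existsP[j /andP[pj p'j]] np].
  exists j, (enum_rank_in pj p, u), (enum_rank_in pj p', v) => /=.
  rewrite !enum_rankK_in //; split=> //; apply: contra np => /eqP h.
  by rewrite -(enum_rankK_in pj pj) h enum_rankK_in.
- move=> j j' a b a' b' nab nab' [ea _] [eb _].
  apply: (hu j j' (enum_val a.1) (enum_val b.1)); rewrite ?enum_valP ?(inj_eq enum_val_inj) //.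
    by rewrite ea enum_valP.
  by rewrite eb enum_valP.
Qed.

Lemma design_GDD1 m : design m <-> GDD 1 m.
Proof.
split=> h.
  apply: (@decomp_bij _ _ _ _ _ _ _ (fun a : 'I_m => (a, ord0)) _ _ _ h).
  - by rewrite card_prod !card_ord muln1.
  - by move=> a b [].
  - by [].
apply: (@decomp_bij _ _ _ _ _ _ _ (fun a : 'I_m * 'I_1 => a.1) _ _ _ h).
- by rewrite card_prod !card_ord muln1.
- by move=> [a u] [b v] /= ->; rewrite !ord1.
- by [].
Qed.

Lemma GDD_weight g m x : TD m x -> GDD g m -> GDD (x * g) m.
Proof.
move=> [W [phi td]] h; pose P := ('I_m * 'I_x)%type.
have pI (p p' : P) : p.1 = p'.1 -> p.2 = p'.2 -> p = p' by case: p p' => [? ?] [? ?] /= -> ->.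
pose A w := td_block phi (fun p : P => p.1) (fun p : P => p.2) w.
have cA w : #|A w| = m.
  rewrite -[RHS](card_ord m) -(card_imset (f := fun i => (i, phi i w) : P)); last by move=> i j [].
  apply: eq_card => -[i z]; rewrite inE /=; apply/eqP/imsetP => [<-|[j _ [-> ->]] //].
  by exists i.
have dec : decomp (fun x y : P * 'I_g => [exists w, (x.1 \in A w) && (y.1 \in A w)] && (x.1 != y.1)).
  apply: decomp_blocks => [w|w w' p p']; first by rewrite cA.
  exact: td_block_uniq.
apply: (@GDD_of_type _ _ _ 'I_m ('I_x * 'I_g)%type); rewrite ?card_prod ?card_ord //.
apply: (@decomp_bij _ _ _ _ _ _ _ (fun a : P * 'I_g => (a.1.1, (a.1.2, a.2))) _ _ _ dec).
- by rewrite !card_prod mulnA.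
- by move=> [[? ?] ?] [[? ?] ?] /= [-> -> ->].
- by move=> a b; rewrite (td_block_exE td pI).
Qed.

Lemma design_groups g m : GDD g m -> design g -> design (m * g).
Proof.
move=> h1 h2; apply: (@design_of_type _ _ _ ('I_m * 'I_g)%type); first by rewrite card_prod !card_ord.
pose r2 (x y : 'I_m * 'I_g) := (x.1 == y.1) && (x.2 != y.2).
apply: (@decomp_union _ _ _ _ (fun x y => x.1 != y.1) r2) h1 _.
  by move=> [a u] [b v]; rewrite /r2 xpair_eqE /=; case: eqP; case: eqP.
apply: (@decomp_pieces _ _ _ _ 'I_m (fun=> 'I_g) _ (fun _ x y => x != y) (fun i u => (i, u))) => //.
- by move=> i u v [].
- by move=> i a b n; rewrite /r2 /= eqxx.
- by move=> [a u] [b v] /andP[/= /eqP -> n]; exists b, u, v.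
- by move=> i j a b a' b' _ _ [].
Qed.

Lemma design_groups_point g m : GDD g m -> design g.+1 -> design (m * g).+1.
Proof.
move=> h1 h2; apply: (@design_of_type _ _ _ (option ('I_m * 'I_g))).
  by rewrite card_option card_prod !card_ord.
pose r1 (x y : option ('I_m * 'I_g)) :=
  match x, y with Some x, Some y => x.1 != y.1 | _, _ => false end.
pose r2 (x y : option ('I_m * 'I_g)) :=
  match x, y with Some x, Some y => (x.1 == y.1) && (x.2 != y.2) | None, None => false | _, _ => true end.
apply: (@decomp_union _ _ _ _ r1 r2).
- case=> [[a u]|] [[b v]|] //=; rewrite (inj_eq (@Some_inj _)) xpair_eqE /=.
  by case: eqP; case: eqP.
- apply: (@decomp_pieces _ _ _ _ unit (fun=> 'I_m * 'I_g)%type _ (fun _ x y => x.1 != y.1) (fun _ x => Some x)) => //.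
  + by move=> _ x y [].
  + by case=> [x|] [y|] //= n; exists tt, x, y.
  + by case; case.
have h2' : decomp (fun x y : option 'I_g => x != y) by apply: design_type; rewrite card_option card_ord.
apply: (@decomp_pieces _ _ _ _ 'I_m (fun=> option 'I_g) _ (fun _ x y => x != y) (fun i u => omap (fun u => (i, u)) u)) => //.
- by move=> i [u|] [v|] //= [->].
- by move=> i [u|] [v|] //= n; rewrite eqxx.
- case=> [[a u]|] [[b v]|] //=.
  + by move=> /andP[/eqP -> n]; exists b, (Some u), (Some v).
  + by move=> _; exists a, (Some u), None.
  + by move=> _; exists b, None, (Some v).
- by move=> i j [u|] [v|] [u'|] [v'|] //= _ _ q1 q2; first [by case: q1 | by case: q2].
Qed.

End Closure.

(** * Truncated transversal designs and holes *)

Lemma exists_bij_extending (X Z : finType) (A : {set X}) n : #|A| = n -> #|X| = #|Z| + n ->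
  exists f : X -> Z + 'I_n, injective f /\
    forall a, (a \in A) = (if f a is inr _ then true else false).
Proof.
move=> cA cX.
have c1 : #|'I_n| = #|A| by rewrite card_ord.
have c2 : #|Z| = #|~: A| by rewrite cardsCs setCK cA cX addnK.
pose g (u : Z + 'I_n) : X := match u with
  | inl z => enum_val (cast_ord c2 (enum_rank z))
  | inr c => enum_val (cast_ord c1 (enum_rank c)) end.
have gA u : (g u \in A) = (if u is inr _ then true else false).
  case: u => [z|c] /=; last by rewrite enum_valP.
  by have := enum_valP (cast_ord c2 (enum_rank z)); rewrite inE => /negbTE.
have gI : injective g.
  move=> u v e; have := gA u; rewrite e gA; case: u v e => [z|c] [z'|c'] //= e _.
    by move/enum_val_inj/cast_ord_inj/enum_rank_inj: e => ->.
  by move/enum_val_inj/cast_ord_inj/enum_rank_inj: e => ->.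
have [|f gK fK] := inj_card_bij gI; first by rewrite card_sum card_ord cX.
exists f; split; first exact: can_inj fK.
by move=> a; rewrite -{1}(fK a) gA.
Qed.

Section Assembly.
Variables (k : nat) (col : 'I_k -> 'I_k -> bool) (mu : bool -> nat).
Local Notation decomp := (decomp col mu).
Local Notation GDD := (GDD col mu).
Local Notation design := (design col mu).

Section Truncated.
Variables (K x y : nat) (yx : y <= x).
Local Notation pts := (('I_K * 'I_x) + 'I_y)%type.

(* A transversal design with [K.+1] groups of size [x], the last one truncated to
   [y] points. *)
Definition trunc_grp (p : pts) : 'I_K.+1 :=
  match p with inl q => widen_ord (leqnSn K) q.1 | inr _ => ord_max end.
Definition trunc_pos (p : pts) : 'I_x :=
  match p with inl q => q.2 | inr u => widen_ord yx u end.

Lemma trunc_pos_inj p p' : trunc_grp p = trunc_grp p' -> trunc_pos p = trunc_pos p' -> p = p'.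
Proof.
have wm (i : 'I_K) : widen_ord (leqnSn K) i <> ord_max.
  by move/(congr1 val) => /= h; have := ltn_ord i; rewrite h ltnn.
case: p p' => [[i z]|u] [[i' z']|u'] /=.
- by move/(congr1 val) => /= /val_inj -> ->.
- by move/wm.
- by move/esym/wm.
- by move=> _ /(congr1 val) /= /val_inj ->.
Qed.

Lemma card_trunc_block (W : finType) (phi : 'I_K.+1 -> W -> 'I_x) w :
  K <= #|td_block phi trunc_grp trunc_pos w| <= K.+1.
Proof.
set A := td_block _ _ _ w; apply/andP; split.
  rewrite -{1}(card_ord K).
  rewrite -(card_imset (f := fun i => inl (i, phi (widen_ord (leqnSn K) i) w) : pts)); last by move=> i j [].
  apply: subset_leq_card; apply/subsetP => _ /imsetP[i _ ->]; by rewrite inE.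
rewrite -(card_in_imset (f := trunc_grp) (D := A)); first by rewrite -[leqRHS]card_ord max_card.
move=> p p'; rewrite !inE => /eqP h /eqP h' e; apply: trunc_pos_inj => //.
by rewrite -h -h' e.
Qed.

Lemma decomp_trunc g : TD K.+1 x -> GDD g K -> GDD g K.+1 ->
  decomp (fun a b : pts * 'I_g => trunc_grp a.1 != trunc_grp b.1).
Proof.
move=> [W [phi td]] h1 h2; pose A := td_block phi trunc_grp trunc_pos.
have hA w : GDD g #|A w|.
  have := card_trunc_block phi w; rewrite leq_eqVlt -/(A w) => /andP[/orP[/eqP <- //|l] l'].
  by have -> : #|A w| = K.+1 by apply/eqP; rewrite eqn_leq l l'.
have := decomp_blocks hA (fun w w' p p' => @td_block_uniq _ _ _ _ _ _ _ td trunc_pos_inj w w' p p').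
by apply: decomp_eq => a b; apply: td_block_exE td trunc_pos_inj _ _.
Qed.

(** Blocks of size [K] or [K.+1] and groups of size [x] or [y] form a pairwise balanced design; all
    of them receive weight [g]. *)
Lemma GDD_trunc g : TD K.+1 x -> GDD g K -> GDD g K.+1 -> GDD g x -> GDD g y -> GDD g (K * x + y).
Proof.
move=> t h1 h2 hx hy; apply: (@GDD_of_type _ _ _ pts 'I_g); rewrite ?card_sum ?card_prod ?card_ord //.
have wm (i : 'I_K) : widen_ord (leqnSn K) i <> ord_max.
  by move/(congr1 val) => /= h; have := ltn_ord i; rewrite h ltnn.
pose A (i : 'I_K.+1) : {set pts} := [set p | trunc_grp p == i].
have hA i : GDD g #|A i|.
  case: (unliftP ord_max i) => [j|] ->.
    have -> : #|A (lift ord_max j)| = x => //.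
    rewrite -[RHS](card_ord x) -(card_imset (f := fun z => inl (j, z) : pts)); last by move=> ? ? [].
    apply: eq_card => -[[i' z]|u]; rewrite inE /=; apply/eqP/imsetP => [e|[z' _]] //.
    - exists z => //; congr (inl (_, _)); apply: val_inj.
      by move/(congr1 val): e => /= ->; rewrite /bump leqNgt ltn_ord.
    - by move=> [-> _]; apply: val_inj; rewrite /= /bump leqNgt ltn_ord.
    - by have := neq_lift ord_max j; rewrite -e eqxx.
  have -> : #|A ord_max| = y => //.
  rewrite -[RHS](card_ord y) -(card_imset (f := fun z => inr z : pts)); last by move=> ? ? [].
  apply: eq_card => -[[i' z]|u]; rewrite inE /=; apply/eqP/imsetP => [e|[z' _]] //.
  - by case: (wm _ e).
  - by exists u.
apply: (decomp_union _ (decomp_trunc t h1 h2) (decomp_blocks hA _)).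
  move=> a b /=; case: (boolP (trunc_grp a.1 == trunc_grp b.1)) => e /=.
    case: eqVneq => [->|n]; rewrite ?andbF // andbT.
    have -> // : [exists j, (a.1 \in A j) && (b.1 \in A j)].
    by apply/existsP; exists (trunc_grp a.1); rewrite !inE eqxx eq_sym.
  have -> : [exists j, (a.1 \in A j) && (b.1 \in A j)] = false.
    by apply/negbTE/existsPn => j; rewrite !inE; apply: contra e => /andP[/eqP -> /eqP ->].
  by have -> : a.1 != b.1 by apply: contra e => /eqP ->.
by move=> j j' p p' _; rewrite !inE => /eqP -> _ /eqP ->.
Qed.
End Truncated.

(* Write m = K x + y with x = 1 modulo (K + 1)! and K <= y <= x; the bound on the
   base cases is what makes y <= x. *)
Lemma GDD_all g K : 0 < K ->
  (forall m, K <= m <= 2 * K + 2 * K * (K * (K.+1)`!) -> GDD g m) ->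
  forall m, K <= m -> GDD g m.
Proof.
move=> K_gt0 base m; elim/ltn_ind: m => m IH Km.
have [l|big] := leqP m (2 * K + 2 * K * (K * (K.+1)`!)); first by apply: base; rewrite Km.
pose P := (K.+1)`!; have P_gt0 : 0 < P by apply: fact_gt0.
have KP : 0 < K * P by rewrite muln_gt0 K_gt0.
(* Of the [2 * K] set aside, one [K] is the lower bound on [y] and the other pays for the term [1]
   in [x]. *)
pose t := (m - 2 * K) %/ (K * P); pose y := K + (m - 2 * K) %% (K * P); pose x := 1 + P * t.
have mE : m = K * x + y.
  have := divn_eq (m - 2 * K) (K * P); rewrite -/t /x /y.
  have -> : K * (1 + P * t) = K + t * (K * P) by ring.
  lia.
have t_ge : 2 * K <= t by rewrite /t leq_divRL // -/P; lia.
have ry : (m - 2 * K) %% (K * P) < K * P by rewrite ltn_mod.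
have yx : y <= x.
  have : P * (2 * K) <= P * t by rewrite leq_mul2l t_ge orbT.
  rewrite /y /x; nia.
have xK : K <= x by apply: leq_trans yx; rewrite leq_addr.
have tdx : TD K.+1 x.
  apply: TD_coprime => //; rewrite /x -/P coprime_sym /coprime mulnC.
  by rewrite addnC gcdnMDl gcdn1.
have NK j : j < 2 -> GDD g (K + j) by move=> j2; apply: base; nia.
rewrite mE; apply: GDD_trunc => //.
- by rewrite -[K]addn0; apply: NK.
- by rewrite -addn1; apply: NK.
- by apply: IH => //; nia.
- by apply: IH; rewrite ?leq_addr //; nia.
Qed.

(** An incomplete design: the hole ['I_n] can be shared by several groups and filled only once. *)
Definition hole_rel (Z : finType) n (a b : Z + 'I_n) :=
  match a, b with inr _, inr _ => false | _, _ => a != b end.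

(** Fill the groups of a transversal design by [hx] and its blocks by [hn], leaving out one block,
    whose [n] points become the hole. *)
Lemma decomp_hole n x (Z : finType) : 1 < n -> 0 < x -> TD n x -> design n -> design x ->
  #|Z| = n * x - n -> decomp (@hole_rel Z n).
Proof.
move=> n_gt1 x_gt0 [W [phi td]] hn hx cZ; pose P := ('I_n * 'I_x)%type.
have pI (p p' : P) : p.1 = p'.1 -> p.2 = p'.2 -> p = p' by case: p p' => [? ?] [? ?] /= -> ->.
pose A := td_block phi (fun p : P => p.1) (fun p : P => p.2).
have cA w : #|A w| = n.
  rewrite -[RHS](card_ord n) -(card_imset (f := fun i => (i, phi i w) : P)); last by move=> i j [].
  apply: eq_card => -[i z]; rewrite inE /=; apply/eqP/imsetP => [<-|[j _ [-> ->]] //].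
  by exists i.
have [w0 _] : exists w0 : W, True.
  have [w _ _] := td (Ordinal (ltnW n_gt1)) (Ordinal n_gt1) isT (Ordinal x_gt0) (Ordinal x_gt0).
  by exists w.
pose J := ({w : W | w != w0} + 'I_n)%type.
pose B (j : J) : {set P} := match j with inl w => A (val w) | inr i => [set p : P | p.1 == i] end.
have hB j : GDD 1 #|B j|.
  case: j => [w|i] /=; apply/design_GDD1; first by rewrite cA.
  have -> : #|[set p : P | p.1 == i]| = x => //.
  rewrite -[RHS](card_ord x) -(card_imset (f := fun z => (i, z) : P)); last by move=> ? ? [].
  apply: eq_card => -[i' z]; rewrite inE /=; apply/eqP/imsetP => [->|[z' _ []]] //.
  by exists z.
have uB j j' p p' : p != p' -> p \in B j -> p' \in B j -> p \in B j' -> p' \in B j' -> j = j'.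
  move=> np; case: j j' => [w|i] [w'|i'] /=.
  - move=> a1 a2 a3 a4; congr inl; apply: val_inj; exact: (td_block_uniq td pI np a1 a2 a3 a4).
  - move=> a1 a2; have := td_block_grp pI np a1 a2; rewrite !inE => n1 /eqP e1 /eqP e2.
    by rewrite e1 e2 eqxx in n1.
  - move=> b1 b2 a1 a2; have := td_block_grp pI np a1 a2; move: b1 b2.
    by rewrite !inE => /eqP -> /eqP ->; rewrite eqxx.
  - by rewrite !inE => /eqP -> _ /eqP ->.
have dec := decomp_blocks hB uB.
have [|f [fI fA]] := @exists_bij_extending P Z (A w0) n (cA w0).
  by rewrite cZ card_prod !card_ord subnK // -{1}(muln1 n) leq_mul2l x_gt0 orbT.
apply: (@decomp_bij _ _ _ _ _ _ _ (fun a : P * 'I_1 => f a.1) _ _ _ dec).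
- by rewrite card_prod card_sum card_ord muln1 cZ card_prod !card_ord subnK // -{1}(muln1 n) leq_mul2l x_gt0 orbT.
- by move=> [a u] [b v] /= /fI ->; rewrite !ord1.
move=> [a u] [b v] /=.
have -> : hole_rel (f a) (f b) = (a != b) && ~~ ((a \in A w0) && (b \in A w0)).
  rewrite !fA /hole_rel -(inj_eq fI); case: (f a) => ?; case: (f b) => ? /=; by rewrite ?andbF ?andbT.
case: (eqVneq a b) => [_|nab] /=; rewrite ?andbF // andbT; apply/existsP/idP => [[[w|i] /= /andP[h1 h2]]|h].
- apply/negP => /andP[h3 h4]; have := valP w.
  by rewrite /= (td_block_uniq (grp := fun p : P => p.1) (pos := fun p : P => p.2) td pI nab h1 h2 h3 h4) eqxx.
- apply/negP => /andP[h3 h4]; have := td_block_grp pI nab h3 h4; move: h1 h2.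
  by rewrite !inE => /eqP -> /eqP ->; rewrite eqxx.
case: (eqVneq a.1 b.1) => [e|n1]; first by exists (inr a.1); rewrite !inE e eqxx.
have [w /andP[h1 h2]] := td_block_ex (grp := fun p : P => p.1) (fun p : P => p.2) td n1.
have nw : w != w0 by apply: contraNneq h => <-; rewrite h1 h2.
by exists (inl (exist _ w nw)); rewrite h1 h2.
Qed.

(** In a truncated transversal design of weight [D], all groups share [n] extra points. The full
    groups are filled with a hole there, and the truncated group completely. *)
Lemma design_assemble K D x y n : y <= x -> TD K.+1 x -> GDD D K -> GDD D K.+1 ->
  decomp (@hole_rel ('I_x * 'I_D)%type n) -> design (y * D + n) ->
  design (K * x * D + y * D + n).
Proof.
move=> yx t h1 h2 hh hl.
pose pts := (('I_K * 'I_x) + 'I_y)%type; pose X := (pts * 'I_D + 'I_n)%type.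
apply: (@design_of_type _ _ _ X).
  by rewrite card_sum card_prod card_sum card_prod !card_ord mulnDl.
(* Three disjoint relations: across groups, within a full group and its links to the hole, and
   within the truncated group together with the hole. *)
pose ra (a b : X) := match a, b with
  | inl p, inl q => trunc_grp p.1 != trunc_grp q.1 | _, _ => false end.
pose rb (a b : X) := match a, b with
  | inl (inl (i, z), u), inl (inl (j, v), w) => (i == j) && ((z, u) != (v, w))
  | inl (inl _, _), inr _ => true | inr _, inl (inl _, _) => true | _, _ => false end.
pose rc (a b : X) := match a, b with
  | inl (inr z, u), inl (inr v, w) => (z, u) != (v, w)
  | inl (inr _, _), inr _ => true | inr _, inl (inr _, _) => true
  | inr c, inr d => c != d | _, _ => false end.
apply: (@decomp_union _ _ _ _ ra (fun a b => rb a b || rc a b)).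
- have wm (i : 'I_K) : (widen_ord (leqnSn K) i == ord_max) = false.
    by apply/negP => /eqP /(congr1 val) /= h; have := ltn_ord i; rewrite h ltnn.
  have ww (i j : 'I_K) : (widen_ord (leqnSn K) i == widen_ord (leqnSn K) j) = (i == j) by [].
  move=> [[[[i z]|z] u]|c] [[[[j v]|v] w]|d] //=; rewrite ?wm ?ww ?(eq_sym ord_max) ?wm ?eqxx //=.
  have inlE (T1 T2 : eqType) (a b : T1) : ((inl a : T1 + T2) == inl b) = (a == b) by [].
  rewrite inlE !xpair_eqE inlE !xpair_eqE; by case: (i == j); case: (z == v); case: (u == w).
- apply: (@decomp_pieces _ _ _ _ unit (fun=> (pts * 'I_D)%type) _ (fun _ a b => trunc_grp a.1 != trunc_grp b.1) (fun _ a => inl a)) => //.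
  + by move=> _; apply: decomp_trunc.
  + by move=> _ a b [].
  + by case=> [a|c] [b|d] //= n0; exists tt, a, b.
  + by case; case.
apply: (@decomp_union _ _ _ _ rb rc).
- by move=> [[[[i z]|z] u]|c] [[[[j v]|v] w]|d] //=; rewrite ?orbF ?addn0.
- apply: (@decomp_pieces _ _ _ _ 'I_K (fun=> ('I_x * 'I_D + 'I_n)%type) _ (fun _ => @hole_rel _ n)
    (fun i a => match a with inl p => inl (inl (i, p.1), p.2) | inr c => inr c end)) => //.
  + by move=> i [[z u]|c] [[v w]|d] //= [] => [-> ->|->].
  + by move=> i [[z u]|c] [[v w]|d] //=; rewrite eqxx.
  + move=> [[[[i z]|z] u]|c] [[[[j v]|v] w]|d] //=.
    * by move=> /andP[/eqP -> ?]; exists j, (inl (z, u)), (inl (v, w)).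
    * by move=> _; exists i, (inl (z, u)), (inr d).
    * by move=> _; exists j, (inr c), (inl (v, w)).
  + by move=> i j [[z u]|c] [[v w]|d] [[z' u']|c'] [[v' w']|d'] //= _ _ q1 q2; first [by case: q1 | by case: q2].
have hl' : decomp (fun a b : ('I_y * 'I_D + 'I_n)%type => a != b).
  by apply: design_type; rewrite card_sum card_prod !card_ord.
apply: (@decomp_pieces _ _ _ _ unit (fun=> ('I_y * 'I_D + 'I_n)%type) _ (fun _ a b => a != b)
    (fun _ a => match a with inl p => inl (inr p.1, p.2) | inr c => inr c end)) => //.
- by move=> _ [[z u]|c] [[v w]|d] //= [] => [-> ->|->].
- by move=> _ [[z u]|c] [[v w]|d] //=.
- move=> [[[[i z]|z] u]|c] [[[[j v]|v] w]|d] //=.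
  + by move=> ?; exists tt, (inl (z, u)), (inl (v, w)).
  + by move=> _; exists tt, (inl (z, u)), (inr d).
  + by move=> _; exists tt, (inr c), (inl (v, w)).
  + by move=> ?; exists tt, (inr c), (inr d).
- by case; case.
Qed.
End Assembly.

(** * Large admissible orders *)

(** A prime above [N + B] is coprime to [N], so Euler's theorem applies. *)
Lemma prime_power_mod N B : 0 < N ->
  exists p t, [/\ prime p, 0 < t, B <= p ^ t & N %| p ^ t - 1].
Proof.
move=> N_gt0; have [p pB pr] := prime_above (N + B).
exists p, (totient N); have t0 : 0 < totient N by rewrite totient_gt0.
have cop : coprime p N.
  by rewrite prime_coprime //; apply/negP => /(dvdn_leq N_gt0); clear -pB; lia.
have pt : p <= p ^ totient N by rewrite -{1}(expn1 p) leq_exp2l ?prime_gt1.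
split=> //; first by clear -pB pt; apply: leq_trans pt; lia.
rewrite -eqn_mod_dvd; first by rewrite Euler_exp_totient.
by rewrite expn_gt0 prime_gt0.
Qed.

Lemma dvd_exp_sub1 N q n : 0 < q -> N %| q - 1 -> N %| q ^ n - 1.
Proof.
move=> q0; rewrite -!eqn_mod_dvd ?expn_gt0 ?q0 // => /eqP h; apply/eqP.
by rewrite -modnXm h modnXm exp1n.
Qed.

Lemma TD_sub k l n : k <= l -> TD l n -> TD k n.
Proof.
move=> kl [W [phi td]]; exists W, (fun i => phi (widen_ord kl i)) => i j nij.
by apply: td.
Qed.

Section Final.
Variables (k1 k2 l1 l2 : nat).
Hypotheses (k1_gt1 : 1 < k1) (k12 : k1 < k2) (l1_gt0 : 0 < l1).
Hypothesis l_eq : l1 * (k2 * (k2 - 1)) = l2 * (k1 * (k1 - 1)).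
Local Notation GDD := (GDD (@nest_col k1 k2) (nest_mu l1 l2)).
Local Notation design := (design (@nest_col k1 k2) (nest_mu l1 l2)).
Local Notation K := (k2 + 4).

Definition admissible v := [/\ k1 - 1 %| l1 * (v - 1), k2 - 1 %| l2 * (v - 1)
  & k1 * (k1 - 1) %| l1 * (v * (v - 1))].

(** Groups of prime power size [q], with [q] one modulo [N], are placed over [v] points and filled
    by [design_field]; the order [v * q] is congruent to [v]. *)
Lemma design_mod v N : admissible v -> K <= v -> 0 < N ->
  exists w, [/\ design w, v <= w & w = v %[mod N]].
Proof.
move=> [a1 a2 a3] vK N_gt0.
have [|||q0 hq0] := @GDD_field k1 k2 l1 l2 v 1 k1_gt1 k12 l1_gt0 l_eq vK isT; rewrite ?muln1 //.
have [q1 hq1] := design_field k1_gt1 k12 l_eq.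
pose M := N * (2 * (k1 * (k1 - 1))).
have M_gt0 : 0 < M by rewrite !muln_gt0 N_gt0 /=; clear -k1_gt1; lia.
have [p [t [pr t0 ptB ptM]]] := prime_power_mod (q0 + q1) M_gt0.
have pt0 : 0 < p ^ t by rewrite expn_gt0 prime_gt0.
have [F _ cF] := pPrimePowerField pr t0.
have tn0 : 0 < t * v.+1 by rewrite muln_gt0 t0.
have [F' _ cF'] := pPrimePowerField pr tn0.
have cFF : #|F'| = #|F| ^ v.+1 by rewrite cF cF' expnM.
have hM : M %| #|F'| - 1 by rewrite cFF cF; apply: dvd_exp_sub1.
have SF' : design #|F'|.
  apply: hq1; last by apply: dvdn_trans hM; apply: dvdn_mull.
  rewrite cFF cF; apply: (@leq_trans (p ^ t)); first by apply: leq_trans ptB; rewrite leq_addl.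
  by rewrite -{1}(expn1 (p ^ t)) leq_pexp2l.
have NGF : GDD #|F'| v.
  have := hq0 F _ v.+1; rewrite mul1n muln1 -cFF; apply=> //.
  by rewrite cF; apply: leq_trans ptB; rewrite leq_addr.
exists (v * #|F'|); split; first exact: design_groups.
  by rewrite leq_pmulr // cF' expn_gt0 prime_gt0.
have h1 : #|F'| = 1 %[mod N].
  apply/eqP; rewrite eqn_mod_dvd; last by rewrite cF' expn_gt0 prime_gt0.
  by apply: dvdn_trans hM; apply: dvdn_mulr.
by rewrite -modnMmr h1 modnMmr muln1.
Qed.

Lemma GDD_interval L : exists g, 0 < g /\ forall m, K <= m <= L -> GDD g m.
Proof.
(* With this [s] all divisibility conditions hold for every [m]. *)
pose s := k1 * (k1 - 1) * (k2 - 1).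
have s_gt0 : 0 < s by rewrite !muln_gt0; clear -k1_gt1 k12; lia.
have /choice [qf hqf] : forall m, exists q0, K <= m -> forall F : finFieldType, q0 <= #|F| ->
    forall n, m * s < n -> GDD (s * #|F| ^ n) m.
  move=> m; case: (leqP K m) => [mK|_]; last by exists 0.
  have [|||q0 h] := @GDD_field k1 k2 l1 l2 m s k1_gt1 k12 l1_gt0 l_eq mK s_gt0.
  - by do 2!apply: dvdn_mull; rewrite /s -mulnA mulnCA; apply: dvdn_mulr.
  - by do 2!apply: dvdn_mull; rewrite /s; apply: dvdn_mull.
  - by do 3!apply: dvdn_mull; rewrite /s; apply: dvdn_mulr.
  by exists q0.
have [p [t [pr t0 ptB _]]] := prime_power_mod (\max_(m < L.+1) qf m) (ltn0Sn 0).
have [F _ cF] := pPrimePowerField pr t0.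
(* The exponent exceeds [m * s] for all [m <= L], so one group size serves the whole interval. *)
exists (s * #|F| ^ (L * s).+1); split.
  by rewrite muln_gt0 s_gt0 expn_gt0 cF expn_gt0 prime_gt0.
move=> m /andP[Km mL]; apply: hqf => //; last by rewrite ltnS leq_mul2r mL orbT.
by rewrite cF; apply: leq_trans ptB; apply: (@leq_bigmax _ (fun m : 'I_L.+1 => qf m) (Ordinal (mL : m < L.+1))).
Qed.

(** [D] is [#|F| - 1 = x * g]: the field is a design on [D + 1] points, and [x] is divisible enough
    for the transversal designs that inflate groups from [g] to [D]. *)
Lemma exists_modulus : exists D, [/\ 0 < D, forall m, K <= m -> GDD D m
  & forall m, K <= m -> design (m * D).+1].
Proof.
pose L := 2 * K + 2 * K * (K * (K.+1)`!).
have [g [g_gt0 gL]] := GDD_interval L.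
have [q1 hq1] := design_field k1_gt1 k12 l_eq.
pose M := g * L`! ^ L * (2 * (k1 * (k1 - 1))).
have M_gt0 : 0 < M by rewrite !muln_gt0 g_gt0 expn_gt0 fact_gt0 /=; clear -k1_gt1; lia.
have [p [t [pr t0 ptB ptM]]] := prime_power_mod (q1 + 2) M_gt0.
have [F _ cF] := pPrimePowerField pr t0.
rewrite -cF in ptB ptM.
have /dvdnP [x xE] : g %| #|F| - 1 by apply: dvdn_trans ptM; rewrite /M -!mulnA; apply: dvdn_mulr.
have x_gt0 : 0 < x by case: x xE => // h; clear -ptB h; lia.
have Lx : L`! ^ L %| x.
  rewrite -(dvdn_pmul2l g_gt0) mulnC [g * x]mulnC -xE mulnC; apply: dvdn_trans ptM.
  exact: dvdn_mulr.
have TDL := TD_dvd_fact x_gt0 Lx.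
have SF : design (x * g).+1.
  rewrite -xE subn1 prednK; last by clear -ptB; lia.
  by apply: hq1; [clear -ptB; lia | apply: dvdn_trans ptM; apply: dvdn_mull].
have GDD_D : forall m, K <= m -> GDD (x * g) m.
  apply: GDD_all; first by rewrite addnC.
  move=> m /andP[Km mL]; apply: GDD_weight; last by apply: gL; rewrite Km.
  exact: TD_sub TDL.
exists (x * g); split=> [|//|m Km]; first by rewrite muln_gt0 x_gt0.
by apply: design_groups_point => //; apply: GDD_D.
Qed.

Section Modulus.
Variable D : nat.
Hypotheses (D_gt0 : 0 < D) (GDD_D : forall m, K <= m -> GDD D m).
Hypothesis design_D : forall m, K <= m -> design (m * D).+1.

(** Pick a design order [s] congruent to [v] modulo [E]. Writing [v - s = E * m2], [s = y * D + w]
    and [m = M * m2] gives [v = K * (w * m) * D + y * D + w], the size produced by [design_assemble]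
    with a hole of size [w]. *)
Lemma design_class w : 1 < w -> design w ->
  exists V, forall v, V <= v -> admissible v -> v = w %[mod D] -> design v.
Proof.
(* In [M], the first factor makes [m * D + 1] coprime to [w] factorial, and the second gives a
   transversal design of order [w * m]. *)
move=> w_gt1 Sw; pose M := w`! * (K.+1)`! ^ K.+1; pose E := K * (w * D * M).
have M_gt0 : 0 < M by rewrite muln_gt0 expn_gt0 !fact_gt0.
have K_gt0 : 0 < K by rewrite addnC.
have E_gt0 : 0 < E by rewrite /E muln_gt0 K_gt0 muln_gt0 M_gt0 muln_gt0 D_gt0 (ltnW w_gt1).
have /choice [sf hsf] : forall c, exists s,
    (exists v, [/\ admissible v, w + K <= v & v = c %[mod E]]) -> [/\ design s, w <= s & s = c %[mod E]].
  move=> c; have [[v [av vw vc]]|no] := pselect (exists v, [/\ admissible v, w + K <= v & v = c %[mod E]]).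
    have [|s [h1 h2 h3]] := design_mod av _ E_gt0; first by apply: leq_trans vw; rewrite leq_addl.
    exists s => _; split=> //; last by rewrite h3.
    by apply: leq_trans h2; apply: leq_trans vw; rewrite leq_addr.
  by exists 0.
pose S := \max_(c < E) sf c.
(* This forces [K + S <= m2]: [K] allows [design_D] at [m], and [S] gives [y <= w * m]. The term
   [w + K] lets [v] itself witness its residue class in [hsf]. *)
exists (S + E * (K + S) + (w + K)) => v vV av vw.
have [|Ss ws sv] := hsf (v %% E).
  exists v; split=> //; last by rewrite modn_mod.
  by apply: leq_trans vV; rewrite leq_addl.
move: (hsf (v %% E)) Ss ws sv => _.
have sS : sf (v %% E) <= S by apply: (@leq_bigmax _ (fun c : 'I_E => sf c) (Ordinal (ltn_pmod v E_gt0))).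
move: (sf (v %% E)) sS => s sS Ss ws; rewrite modn_mod => sv.
have sv_le : s <= v.
  by apply: (leq_trans sS); apply: leq_trans vV; rewrite -addnA leq_addr.
have /dvdnP [m2 m2E] : E %| v - s by rewrite -eqn_mod_dvd // sv.
have m2_ge : K + S <= m2.
  rewrite -(leq_pmul2r E_gt0) -m2E mulnC leq_subRL //; apply: leq_trans vV.
  by apply: leq_trans (leq_addr _ _); rewrite leq_add2r.
have DE : D %| E by rewrite /E; apply: dvdn_mull; rewrite -mulnA mulnCA; apply: dvdn_mulr.
have swD : s = w %[mod D] by rewrite -vw -(modn_dvdm v DE) -(modn_dvdm s DE) sv.
have /dvdnP [y yE] : D %| s - w by rewrite -eqn_mod_dvd // swD.
pose m := M * m2.
have m_ge : m2 <= m by rewrite leq_pmull.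
have y_le : y <= w * m.
  apply: (@leq_trans (s - w)); first by rewrite yE leq_pmulr.
  apply: (leq_trans (leq_subr _ _)); apply: (leq_trans sS).
  apply: (@leq_trans m2); first by apply: leq_trans m2_ge; rewrite leq_addl.
  by apply: (leq_trans m_ge); rewrite leq_pmull // ltnW.
have wm : w`! %| m by rewrite /m /M -mulnA dvdn_mulr.
have x_gt0 : 0 < w * m by rewrite muln_gt0 (ltnW w_gt1) /=; apply: leq_trans m_ge; apply: leq_trans m2_ge; rewrite addn_gt0 K_gt0.
have tdx : TD K.+1 (w * m).
  by apply: TD_dvd_fact => //; rewrite /m /M; apply: dvdn_mull; rewrite -mulnA mulnCA dvdn_mulr.
have hole : decomp (@nest_col k1 k2) (nest_mu l1 l2) (@hole_rel ('I_(w * m) * 'I_D)%type w).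
  apply: (@decomp_hole _ _ _ w (m * D).+1) => //.
  - apply: TD_coprime => //; rewrite coprime_sym -addn1.
    case/dvdnP: wm => z ->; rewrite mulnAC /coprime gcdnMDl gcdn1 //.
  - by apply: design_D; apply: leq_trans m_ge; apply: leq_trans m2_ge; rewrite leq_addr.
  - by rewrite card_prod !card_ord mulnS addKn mulnA.
have Sy : design (y * D + w) by rewrite -yE subnK.
have := design_assemble y_le tdx (GDD_D (leqnn K)) (GDD_D (leqnSn K)) hole Sy.
have -> // : K * (w * m) * D + y * D + w = v.
rewrite -addnA -yE subnK // -(subnK sv_le) m2E /E /m; congr (_ + s); ring.
Qed.

End Modulus.

Lemma design_eventually : exists v0, forall v, v0 <= v -> admissible v -> design v.
Proof.
have [D [D_gt0 GDD_D design_D]] := exists_modulus.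
have /choice [Vf hV] : forall f, exists V, forall v, V <= v -> admissible v -> v = f %[mod D] -> design v.
  move=> f; have [[v [av vK vf]]|no] := pselect (exists v, [/\ admissible v, K <= v & v = f %[mod D]]).
    have [w [Sw wv wD]] := design_mod av vK D_gt0.
    have [|V hV] := design_class D_gt0 GDD_D design_D _ Sw.
      by apply: leq_trans wv; apply: leq_trans vK; rewrite addnC.
    by exists V => u uV au uf; apply: hV => //; rewrite wD vf.
  by exists K => v vK av vf; case: no; exists v.
exists (\max_(f < D) Vf f) => v vV av; apply: (hV (v %% D)) => //; last by rewrite modn_mod.
by apply: leq_trans vV; apply: (@leq_bigmax _ (fun c : 'I_D => Vf c) (Ordinal (ltn_pmod v D_gt0))).
Qed.

(** Blocks are injective, so [hits] off the diagonal is 0 or 1: colour [true] detects pairs in [B'],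
    and the two colours together detect pairs in [B]. *)
Lemma nesting_of_design v : design v -> has_nesting k2 l2 k1 l1 v.
Proof.
move=> [I [b hb]].
have bI i : injective (b i).
  move=> p p' e; apply/eqP; apply: contraT => npp.
  have := hb (nest_col k1 p p') (b i p) (b i p); rewrite eqxx muln0 => /eqP.
  rewrite sum_nat_eq0 => /forallP/(_ i) /=; rewrite /hits sum_nat_eq0 => /forallP/(_ (p, p')) /=.
  by rewrite npp !eqxx -e eqxx.
pose B i := [set b i p | p : 'I_k2]; pose B' i := [set b i p | p : 'I_k2 & p < k1].
have inj1 i (R : pred ('I_k2 * 'I_k2)) x y :
    \sum_(p | R p) ((b i p.1 == x) && (b i p.2 == y)) =
    [exists p, R p && ((b i p.1 == x) && (b i p.2 == y))].
  case: (boolP [exists p, _]) => [/existsP[q /and3P[Rq /eqP qx /eqP qy]]|/existsPn no].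
    rewrite (bigD1 q) //= qx qy !eqxx big1 // => p /andP[_ npq].
    case: eqP => //= px; case: eqP => //= py; case/eqP: npq.
    by rewrite [p]surjective_pairing [q]surjective_pairing; congr pair; apply: (bI i); rewrite ?px ?py.
  by rewrite big1 // => p Rp; move: (no p); rewrite Rp /= => /negbTE ->.
have B'E i x y : x != y -> (x \in B' i) && (y \in B' i) = hits (@nest_col k1 k2) (b i) true x y :> nat.
  move=> nxy; rewrite /hits inj1; congr nat_of_bool; apply/andP/existsP.
    move=> [/imsetP[p pk ex] /imsetP[q qk ey]]; rewrite !inE in pk qk.
    exists (p, q); rewrite /= -ex -ey !eqxx /nest_col pk qk !andbT.
    by apply: contra nxy => /eqP ep; rewrite ex ey ep.
  by move=> [[p q] /= /andP[/andP[npq /eqP/andP[pk qk]] /andP[/eqP <- /eqP <-]]]; split; apply: imset_f; rewrite inE.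
have BE i x y : x != y -> (x \in B i) && (y \in B i) =
    hits (@nest_col k1 k2) (b i) true x y + hits (@nest_col k1 k2) (b i) false x y :> nat.
  move=> nxy.
  have -> : hits (@nest_col k1 k2) (b i) true x y + hits (@nest_col k1 k2) (b i) false x y =
     \sum_(p : 'I_k2 * 'I_k2 | p.1 != p.2) ((b i p.1 == x) && (b i p.2 == y)).
    rewrite [RHS](bigID (fun p => nest_col k1 p.1 p.2)) /hits; congr (_ + _).
      by apply: eq_bigl => p; rewrite eqb_id.
    by apply: eq_bigl => p; rewrite eqbF_neg.
  rewrite inj1; congr nat_of_bool; apply/andP/existsP.
    move=> [/imsetP[p _ ex] /imsetP[q _ ey]]; exists (p, q); rewrite /= -ex -ey !eqxx !andbT.
    by apply: contra nxy => /eqP ep; rewrite ex ey ep.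
  by move=> [[p q] /= /andP[_ /andP[/eqP <- /eqP <-]]]; split; apply: imset_f.
have l12 := nest_lambda_le k1_gt1 k12 l_eq.
exists 'I_v, I, B, B'; split; first split.
- by rewrite card_ord.
- by move=> i; rewrite card_imset // card_ord.
- move=> x y nxy; rewrite -sum1dep_card big_mkcond /=.
  transitivity (\sum_i (hits (@nest_col k1 k2) (b i) true x y + hits (@nest_col k1 k2) (b i) false x y)).
    by apply: eq_bigr => i _; rewrite -BE //; case: (_ && _).
  by rewrite big_split /= !hb nxy !muln1 /= subnKC.
- by move=> i; apply/subsetP => _ /imsetP[p _ ->]; apply: imset_f.
split.
- by rewrite card_ord.
- move=> i; rewrite card_imset // -[RHS](card_lt_ord (ltnW k12)); apply: eq_card => p; by rewrite !inE.
- move=> x y nxy; rewrite -sum1dep_card big_mkcond /=.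
  transitivity (\sum_i (hits (@nest_col k1 k2) (b i) true x y)).
    by apply: eq_bigr => i _; rewrite -B'E //; case: (_ && _).
  by rewrite hb nxy muln1.
Qed.
End Final.

Theorem theorem1p5 (k1 k2 lambda1 lambda2 : nat)
    (k1_gt0 : 0 < k1) (k1_lt_k2 : k1 < k2)
    (lambda1_gt0 : 0 < lambda1) (lambda2_gt0 : 0 < lambda2)
    (lambda_eq : lambda1 * (k2 * (k2 - 1)) = lambda2 * (k1 * (k1 - 1))) :
  exists v0 : nat, forall v : nat, v0 <= v ->
    lambda1 * (v - 1) = 0 %[mod k1 - 1] ->
    lambda1 * (v * (v - 1)) = 0 %[mod k1 * (k1 - 1)] ->
    lambda2 * (v - 1) = 0 %[mod k2 - 1] ->
    has_nesting k2 lambda2 k1 lambda1 v.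
Proof.
(* For [k1 = 1] the right side of [lambda_eq] vanishes while the left side does not. *)
have k1_gt1 : 1 < k1.
  rewrite ltnNge; apply/negP => k1_le1; have k1E : k1 - 1 = 0 by lia.
  move: lambda_eq; rewrite k1E !muln0 => /eqP; rewrite !muln_eq0; lia.
have [v0 hv0] := design_eventually k1_gt1 k1_lt_k2 lambda1_gt0 lambda_eq.
exists v0 => v vv; rewrite !mod0n => h1 h2 h3.
apply: nesting_of_design => //; apply: hv0 => //.
by split; apply/eqP.
Qed.
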